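(* Let $\mathcal{A}=(\mathbf{A}_1,\mathbf{A})$ and $\mathcal{B}=(\mathbf{B}_1,\mathbf{B})$ be quantum spaces (objects of $\mathrm{FGA}$) and let $\psi\in\mathfrak{Z}^2[\mathbf{A}_1]$, $\varphi\in\mathfrak{Z}^2[\mathbf{B}_1]$ be counital 2-cocycles, admissible for $\mathcal{A}$ and $\mathcal{B}$ respectively. Then $\mathfrak{j}(\psi,\varphi)\in\mathfrak{Z}^2[\mathbf{A}_1\otimes\mathbf{B}_1]$ is $\mathcal{A}\circ\mathcal{B}$-admissible and $$\mathcal{A}_\psi\circ\mathcal{B}_\varphi\simeq(\mathcal{A}\circ\mathcal{B})_{\mathfrak{j}(\psi,\varphi)} .$$
   Context: $\Bbbk$ is $\mathbb{R}$ or $\mathbb{C}$. A quantum space (object of $\mathrm{FGA}$) is a pair $\mathcal{A}=(\mathbf{A}_1,\mathbf{A})$ with $\mathbf{A}$ a unital associative $\Bbbk$-algebra generated by a finite-dimensional subspace $\mathbf{A}_1$; morphisms are unital algebra maps sending $\mathbf{A}_1$ into $\mathbf{B}_1$; $\Pi:\mathbf{A}_1^\otimes\twoheadrightarrow\mathbf{A}$ is the canonical epimorphism from the tensor algebra. $\mathcal{A}\circ\mathcal{B}=(\mathbf{A}_1\otimes\mathbf{B}_1,\mathbf{A}\circ\mathbf{B})$, with $\mathbf{A}\circ\mathbf{B}$ the subalgebra of $\mathbf{A}\otimes\mathbf{B}$ generated by $\mathbf{A}_1\otimes\mathbf{B}_1$. For a vector space $\mathbf{V}$, $\mathsf{C}^2[\mathbf{V}]$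 is the group of linear automorphisms $\psi$ of $\mathbf{V}^\otimes\otimes\mathbf{V}^\otimes$ preserving each $\mathbf{V}^{\otimes r}\otimes\mathbf{V}^{\otimes s}$, with restrictions $\psi_{r,s}$. Identifying $\mathbf{V}^{\otimes r}\otimes\mathbf{V}^{\otimes s}\cong\mathbf{V}^{\otimes r+s}$ by multiplication, $\psi$ is a 2-cocycle if $\psi_{r+s,t}(\psi_{r,s}\otimes id_t)=\psi_{r,s+t}(id_r\otimes\psi_{s,t})$ for all $r,s,t$; counital if $\psi(1\otimes a)=1\otimes a$, $\psi(a\otimes1)=a\otimes1$. $\mathfrak{Z}^2[\mathbf{V}]$ is the set of counital 2-cocycles. $\psi\in\mathsf{C}^2[\mathbf{A}_1]$ is $\mathcal{A}$-admissible if $\psi(\ker\Pi^{\otimes2})=\ker\Pi^{\otimes2}$. For $\mathcal{A}$-admissible $\psi\in\mathfrak{Z}^2[\mathbf{A}_1]$ the twisting $\mathcal{A}_\psi=(\mathbf{A}_1,\mathbf{A}_\psi)$ is the quantum space with $\mathbf{A}_\psi$ the vector space $\mathbf{A}$ with the same unit and product $m\,\Psi$, where $\Psi\,\Pi^{\otimes2}=\Pi^{\otimes2}\psi$. For $\psi\in\mathsf{C}^2[\mathbf{V}]$, $\varphi\in\mathsf{C}^2[\mathbf{W}]$, $\mathfrak{j}(\psi,\varphi)\in\mathsf{C}^2[\mathbf{V}\otimes\mathbf{W}]$ is given on $(\mathbf{V}\otimes\mathbf{W})^{\otimes r}\otimes(\mathbf{V}\otimes\mathbf{W})^{\otimes s}$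 by $\psi_{r,s}\otimes\varphi_{r,s}$, under the canonical (reordering) isomorphism of this space with $(\mathbf{V}^{\otimes r}\otimes\mathbf{V}^{\otimes s})\otimes(\mathbf{W}^{\otimes r}\otimes\mathbf{W}^{\otimes s})$. *)

(* Defs.v *)
From HB Require Import structures.
From mathcomp Require Import all_boot all_order all_algebra.
From mathcomp Require Import boolp classical_sets reals complex.

Set Implicit Arguments.
Unset Strict Implicit.
Unset Printing Implicit Defensive.

Import GRing.Theory.
Local Open Scope ring_scope.
Local Open Scope quotient_scope.
Local Open Scope classical_set_scope.

Variant scalars := RealScalars | ComplexScalars.

Definition ground_field (R : realType) (c : scalars) : fieldType :=
  match c with RealScalars => R | ComplexScalars => R[i] end.

(* Unital associative algebras. The library's [algType] also requires 1 != 0,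
   which would exclude the zero algebra. *)
HB.mixin Record Lmodule_isUAlgebra (k : pzRingType) A of GRing.Lmodule k A := {
  aone : A;
  amul : A -> A -> A;
  amulA : associative amul;
  amul1l : left_id aone amul;
  amul1r : right_id aone amul;
  amul_linl : forall y, linear (amul^~ y);
  amul_linr : forall x, linear (amul x)
}.

#[short(type="ualgType")]
HB.structure Definition UAlgebra (k : pzRingType) :=
  {A of GRing.Lmodule k A & Lmodule_isUAlgebra k A}.

Notation "x ⋅ y" := (amul x y) (at level 40, left associativity) : ring_scope.
Notation "𝟙" := (@aone _ _) : ring_scope.

Section LinearSpan.
Variables (k : fieldType) (V : lmodType k).

Inductive span (S : set V) : set V :=
| span0 : span S 0
| span_gen v of S v : span S v
| spanD v w of span S v & span S w : span S (v + w)
| spanZ a v of span S v : span S (a *: v).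

End LinearSpan.

Inductive subalg (k : fieldType) (A : ualgType k) (S : set A) : set A :=
| subalg1 : subalg S 𝟙
| subalg_gen x of S x : subalg S x
| subalgD x y of subalg S x & subalg S y : subalg S (x + y)
| subalgZ a x of subalg S x : subalg S (a *: x)
| subalgM x y of subalg S x & subalg S y : subalg S (x ⋅ y).

(* The tensor product is presented by generators [v ⊗ w] and relations: formal
   linear combinations modulo the congruence generated by the axioms of vector
   spaces and bilinearity. *)
Section Tensor.
Variables (k : fieldType) (V W : lmodType k).

Inductive tens_term :=
| TPure of V & W
| TZero
| TAdd of tens_term & tens_term
| TScale of k & tens_term.

Inductive tens_rel : tens_term -> tens_term -> Prop :=
| trel_refl x : tens_rel x x
| trel_sym x y of tens_rel x y : tens_rel y x
| trel_trans x y z of tens_rel x y & tens_rel y z : tens_rel x z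
| trel_add x x' y y' of tens_rel x x' & tens_rel y y' :
    tens_rel (TAdd x y) (TAdd x' y')
| trel_scale a x x' of tens_rel x x' : tens_rel (TScale a x) (TScale a x')
| trel_addA x y z : tens_rel (TAdd x (TAdd y z)) (TAdd (TAdd x y) z)
| trel_addC x y : tens_rel (TAdd x y) (TAdd y x)
| trel_add0 x : tens_rel (TAdd TZero x) x
| trel_scaleA a b x : tens_rel (TScale a (TScale b x)) (TScale (a * b) x)
| trel_scale0 x : tens_rel (TScale 0 x) TZero
| trel_scale1 x : tens_rel (TScale 1 x) x
| trel_scaleDr a x y :
    tens_rel (TScale a (TAdd x y)) (TAdd (TScale a x) (TScale a y))
| trel_scaleDl a b x :
    tens_rel (TScale (a + b) x) (TAdd (TScale a x) (TScale b x))
| trel_linl a v v' w :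
    tens_rel (TPure (a *: v + v') w) (TAdd (TScale a (TPure v w)) (TPure v' w))
| trel_linr a v w w' :
    tens_rel (TPure v (a *: w + w')) (TAdd (TScale a (TPure v w)) (TPure v w')).

HB.instance Definition _ := gen_eqMixin tens_term.
HB.instance Definition _ := gen_choiceMixin tens_term.

Definition tens_eqv (x y : tens_term) : bool := `[< tens_rel x y >].

Lemma tens_eqvP : equiv_class_of tens_eqv.
Proof.
split=> [x|x y|y x z].
- by apply/asboolP; exact: trel_refl.
- by apply/asboolP/asboolP; exact: trel_sym.
- by move=> /asboolP xy /asboolP yz; apply/asboolP; exact: trel_trans xy yz.
Qed.

Canonical tens_equiv := EquivRelPack tens_eqvP.

Definition tensor := {eq_quot tens_equiv}.
HB.instance Definition _ := Choice.on tensor.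
HB.instance Definition _ := EqQuotient.on tensor.

Lemma tens_piP x y : tens_rel x y <-> \pi_tensor x = \pi_tensor y.
Proof.
split=> [xy|/eqmodP/asboolP//]; exact/eqmodP/asboolP.
Qed.

Lemma tens_reprP x : tens_rel (repr (\pi_tensor x)) x.
Proof. by apply/tens_piP; rewrite reprK. Qed.

Definition tens (v : V) (w : W) : tensor := \pi_tensor (TPure v w).
Definition tens_zero : tensor := \pi_tensor TZero.
Definition tens_add (x y : tensor) : tensor := \pi_tensor (TAdd (repr x) (repr y)).
Definition tens_scale a (x : tensor) : tensor := \pi_tensor (TScale a (repr x)).

Lemma tens_addE x y :
  tens_add (\pi_tensor x) (\pi_tensor y) = \pi_tensor (TAdd x y).
Proof. by apply/tens_piP/trel_add; exact: tens_reprP. Qed.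

Lemma tens_scaleE a x : tens_scale a (\pi_tensor x) = \pi_tensor (TScale a x).
Proof. by apply/tens_piP/trel_scale; exact: tens_reprP. Qed.

Lemma tens_ind_pi (P : tensor -> Prop) :
  (forall x, P (\pi_tensor x)) -> forall x, P x.
Proof. by move=> H x; rewrite -[x]reprK. Qed.

Fact tens_addA : associative tens_add.
Proof.
move=> x y z; elim/tens_ind_pi: x => x; elim/tens_ind_pi: y => y.
elim/tens_ind_pi: z => z; rewrite !tens_addE; exact/tens_piP/trel_addA.
Qed.

Fact tens_addC : commutative tens_add.
Proof.
move=> x y; elim/tens_ind_pi: x => x; elim/tens_ind_pi: y => y.
rewrite !tens_addE; exact/tens_piP/trel_addC.
Qed.

Fact tens_add0 : left_id tens_zero tens_add.
Proof.
elim/tens_ind_pi=> x; rewrite tens_addE; exact/tens_piP/trel_add0.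
Qed.

Fact tens_scaleDl' a b x :
  tens_scale (a + b) x = tens_add (tens_scale a x) (tens_scale b x).
Proof.
elim/tens_ind_pi: x => x.
rewrite !tens_scaleE tens_addE; exact/tens_piP/trel_scaleDl.
Qed.

Fact tens_scale0 x : tens_scale 0 x = tens_zero.
Proof.
elim/tens_ind_pi: x => x; rewrite tens_scaleE; exact/tens_piP/trel_scale0.
Qed.

Fact tens_scale1 : left_id 1 tens_scale.
Proof.
elim/tens_ind_pi=> x; rewrite tens_scaleE; exact/tens_piP/trel_scale1.
Qed.

Fact tens_addN : left_inverse tens_zero (tens_scale (-1)) tens_add.
Proof.
move=> x; rewrite -{2}[x]tens_scale1 -tens_scaleDl' addNr; exact: tens_scale0.
Qed.

HB.instance Definition _ :=
  GRing.isZmodule.Build tensor tens_addA tens_addC tens_add0 tens_addN.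

Fact tens_scaleA a b x :
  tens_scale a (tens_scale b x) = tens_scale (a * b) x.
Proof.
elim/tens_ind_pi: x => x; rewrite !tens_scaleE; exact/tens_piP/trel_scaleA.
Qed.

Fact tens_scaleDr : right_distributive tens_scale +%R.
Proof.
move=> a; elim/tens_ind_pi=> x; elim/tens_ind_pi=> y.
rewrite /GRing.add /= !(tens_scaleE, tens_addE); exact/tens_piP/trel_scaleDr.
Qed.

Fact tens_scaleDl x : {morph tens_scale^~ x : a b / a + b}.
Proof. by move=> a b; exact: tens_scaleDl'. Qed.

HB.instance Definition _ := GRing.Zmodule_isLmodule.Build k tensor
  tens_scaleA tens_scale1 tens_scaleDr tens_scaleDl.

Lemma tens_linl w : linear (tens^~ w).
Proof.
move=> a v v'; rewrite /tens /GRing.add /GRing.scale /= tens_scaleE tens_addE.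
exact/tens_piP/trel_linl.
Qed.

Lemma tens_linr v : linear (tens v).
Proof.
move=> a w w'; rewrite /tens /GRing.add /GRing.scale /= tens_scaleE tens_addE.
exact/tens_piP/trel_linr.
Qed.

Lemma tens_ind (P : tensor -> Prop) :
    (forall v w, P (tens v w)) -> P 0 ->
    (forall x y, P x -> P y -> P (x + y)) ->
    (forall a x, P x -> P (a *: x)) ->
  forall x, P x.
Proof.
move=> Pt P0 PD PZ; elim/tens_ind_pi; elim=> [v w||x Px y Py|a x Px].
- exact: Pt.
- exact: P0.
- by rewrite -tens_addE; exact: PD.
- by rewrite -tens_scaleE; exact: PZ.
Qed.

Section Lift.
Variable X : lmodType k.
Implicit Type f : V -> W -> X.

Definition bilin f := (forall w, linear (f^~ w)) /\ (forall v, linear (f v)).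

Fixpoint tens_eval f (x : tens_term) : X :=
  match x with
  | TPure v w => f v w
  | TZero => 0
  | TAdd x y => tens_eval f x + tens_eval f y
  | TScale a x => a *: tens_eval f x
  end.

(* The linear map [v ⊗ w |-> f v w], for bilinear f. *)
Definition tlift f (x : tensor) : X := tens_eval f (repr x).

Lemma tens_eval_rel f x y :
  bilin f -> tens_rel x y -> tens_eval f x = tens_eval f y.
Proof.
move=> [fl fr]; elim=> {x y} /=; do ?by [].
- by move=> ? ? ? _ -> _ ->.
- by move=> ? ? ? ? _ -> _ ->.
- by move=> ? ? ? _ ->.
- by move=> *; rewrite addrA.
- by move=> *; rewrite addrC.
- by move=> *; rewrite add0r.
- by move=> *; rewrite scalerA.
- by move=> *; rewrite scale0r.
- by move=> *; rewrite scale1r.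
- by move=> *; rewrite scalerDr.
- by move=> *; rewrite scalerDl.
- by move=> *; exact: fl.
- by move=> *; exact: fr.
Qed.

Lemma tlift_pi f x : bilin f -> tlift f (\pi_tensor x) = tens_eval f x.
Proof. by move=> bf; apply: tens_eval_rel => //; exact: tens_reprP. Qed.

Lemma tlift_tens f v w : bilin f -> tlift f (tens v w) = f v w.
Proof. by move=> bf; rewrite tlift_pi. Qed.

Lemma tlift_linear f : bilin f -> linear (tlift f).
Proof.
move=> bf a; elim/tens_ind_pi=> x; elim/tens_ind_pi=> y.
by rewrite [_ *: _]tens_scaleE [_ + _]tens_addE !tlift_pi.
Qed.

End Lift.

End Tensor.

Notation "v ⊗ w" := (tens v w) (at level 40, left associativity) : ring_scope.

(* Linearity of plain functions. *)
Section LinearFun.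
Variables (k : fieldType) (U V X : lmodType k).

Lemma linD (f : U -> V) : linear f -> {morph f : x y / x + y}.
Proof. by move=> fl x y; have := fl 1 x y; rewrite !scale1r. Qed.

Lemma lin0 (f : U -> V) : linear f -> f 0 = 0.
Proof.
by move=> fl; apply: (addrI (f 0)); rewrite -linD// !addr0.
Qed.

Lemma linZ (f : U -> V) a : linear f -> {morph f : x / a *: x}.
Proof. by move=> fl x; have := fl a x 0; rewrite lin0// !addr0. Qed.

Lemma lin_comp (g : V -> X) (f : U -> V) :
  linear g -> linear f -> linear (g \o f).
Proof. by move=> gl fl a x y /=; rewrite fl gl. Qed.

Lemma lin_id : linear (@id U).
Proof. by []. Qed.

Lemma span_ind_lin (S : set U) (f g : U -> V) : linear f -> linear g ->
  (forall x, S x -> f x = g x) -> forall x, span S x -> f x = g x.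
Proof.
move=> fl gl fg x; elim=> {x}; first by rewrite !lin0.
- exact: fg.
- by move=> v w _ fv _ fw; rewrite !(linD fl, linD gl) fv fw.
- by move=> a v _ fv; rewrite (linZ _ fl) (linZ _ gl) fv.
Qed.

End LinearFun.

Lemma tens_eqlin (k : fieldType) (V W X : lmodType k) (f g : tensor V W -> X) :
  linear f -> linear g -> (forall v w, f (v ⊗ w) = g (v ⊗ w)) -> f =1 g.
Proof.
move=> fl gl fg; elim/tens_ind=> [//||x y fx fy|a x fx].
- by rewrite !lin0.
- by rewrite (linD fl) (linD gl) fx fy.
- by rewrite (linZ _ fl) (linZ _ gl) fx.
Qed.

Section TensorMap.
Variables (k : fieldType) (V V' W W' : lmodType k).

Definition tmap (f : V -> V') (g : W -> W') : tensor V W -> tensor V' W' :=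
  tlift (fun v w => f v ⊗ g w).

Lemma tmap_bilin (f : V -> V') (g : W -> W') : linear f -> linear g ->
  bilin (fun v w => f v ⊗ g w : tensor V' W').
Proof.
move=> fl gl; split=> [w a v v'|v a w w'] /=.
  by rewrite fl tens_linl.
by rewrite gl tens_linr.
Qed.

Lemma tmap_tens (f : V -> V') (g : W -> W') v w : linear f -> linear g ->
  tmap f g (v ⊗ w) = f v ⊗ g w.
Proof. by move=> fl gl; rewrite /tmap tlift_tens//; exact: tmap_bilin. Qed.

Lemma tmap_linear (f : V -> V') (g : W -> W') : linear f -> linear g -> linear (tmap f g).
Proof. by move=> fl gl; apply: tlift_linear; exact: tmap_bilin. Qed.

End TensorMap.

Section TensorAlgebraProduct.
Variables (k : fieldType) (A B : ualgType k).

(* The product [(a ⊗ b) (a' ⊗ b') = (a ⋅ a') ⊗ (b ⋅ b')]. *)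
Definition tens_mul (x y : tensor A B) : tensor A B :=
  tlift (fun a b => tmap (amul a) (amul b) y) x.

Lemma tens_mul_bilin y :
  bilin (fun (a : A) (b : B) => tmap (amul a) (amul b) y).
Proof.
have L (a : A) (b : B) := tmap_linear (amul_linr a) (amul_linr b).
have T (a : A) (b : B) v w := tmap_tens v w (amul_linr a) (amul_linr b).
split=> [b c a a'|a c b b'].
  elim/tens_ind: y => [v w||x y Hx Hy|d x Hx].
  - by rewrite !T amul_linl tens_linl.
  - by rewrite !(lin0 (L _ _)) scaler0 addr0.
  - by rewrite !(linD (L _ _)) Hx Hy scalerDr addrACA.
  - by rewrite !(linZ _ (L _ _)) Hx scalerDr !scalerA mulrC.
elim/tens_ind: y => [v w||x y Hx Hy|d x Hx].
- by rewrite !T amul_linl tens_linr.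
- by rewrite !(lin0 (L _ _)) scaler0 addr0.
- by rewrite !(linD (L _ _)) Hx Hy scalerDr addrACA.
- by rewrite !(linZ _ (L _ _)) Hx scalerDr !scalerA mulrC.
Qed.

Lemma tens_mulE a b a' b' : tens_mul (a ⊗ b) (a' ⊗ b') = (a ⋅ a') ⊗ (b ⋅ b').
Proof.
rewrite /tens_mul tlift_tens; last exact: tens_mul_bilin.
by rewrite tmap_tens//; exact: amul_linr.
Qed.

Lemma tens_mul_linl y : linear (tens_mul^~ y).
Proof. by apply: tlift_linear; exact: tens_mul_bilin. Qed.

Lemma tens_mul_linr x : linear (tens_mul x).
Proof.
move=> c y z; elim/tens_ind: x => [a b||x x' Hx Hx'|d x Hx].
- rewrite /tens_mul !tlift_tens; try exact: tens_mul_bilin.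
  by rewrite tmap_linear//; exact: amul_linr.
- by rewrite !(lin0 (tens_mul_linl _)) scaler0 addr0.
- by rewrite !(linD (tens_mul_linl _)) Hx Hx' scalerDr addrACA.
- by rewrite !(linZ _ (tens_mul_linl _)) Hx scalerDr !scalerA mulrC.
Qed.

Fact tens_mulA : associative tens_mul.
Proof.
move=> x y z.
move: x; apply: tens_eqlin.
- exact: tens_mul_linl.
- by apply: (lin_comp (g := tens_mul^~ z)); exact: tens_mul_linl.
move=> a b; move: y; apply: tens_eqlin.
- by apply: (lin_comp (f := tens_mul^~ z));
    [exact: tens_mul_linr|exact: tens_mul_linl].
- by apply: (lin_comp (g := tens_mul^~ z));
    [exact: tens_mul_linl|exact: tens_mul_linr].
move=> a' b'; move: z; apply: tens_eqlin.
- by apply: lin_comp; exact: tens_mul_linr.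
- exact: tens_mul_linr.
by move=> a'' b''; rewrite !tens_mulE !amulA.
Qed.

Fact tens_mul1l : left_id (𝟙 ⊗ 𝟙) tens_mul.
Proof.
apply: tens_eqlin; [exact: tens_mul_linr|exact: lin_id|].
by move=> a b; rewrite tens_mulE !amul1l.
Qed.

Fact tens_mul1r : right_id (𝟙 ⊗ 𝟙) tens_mul.
Proof.
apply: tens_eqlin; [exact: tens_mul_linl|exact: lin_id|].
by move=> a b; rewrite tens_mulE !amul1r.
Qed.

HB.instance Definition _ := Lmodule_isUAlgebra.Build k (tensor A B)
  tens_mulA tens_mul1l tens_mul1r tens_mul_linl tens_mul_linr.

End TensorAlgebraProduct.

Section Complement.
Variables (k : fieldType) (U V : lmodType k).

Lemma lin_left_inverse (f : U -> V) : linear f -> injective f ->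
  exists2 g : V -> U, linear g & cancel f g.
Proof.
move=> fl fi.
pose P (C : set V) := (forall a x y, C x -> C y -> C (a *: x + y)) /\
  (forall u, C (f u) -> u = 0).
have [F FP Ftot|C [[Clin C0] Cmax]] := @Zorn_bigcup V P.
  split=> [a x y [X1 FX1 X1x] [X2 FX2 X2y]|u [X1 FX1 X1u]]; last first.
    by have [_] := FP _ FX1; apply.
  have [X12|X21] := Ftot _ _ FX1 FX2.
    by exists X2 => //; apply: (FP _ FX2).1 => //; exact: X12.
  by exists X1 => //; apply: (FP _ FX1).1 => //; exact: X21.
have C00 : C 0.
  apply: contrapT => nC0.
  have nC : forall x, ~ C x.
    by move=> x Cx; apply: nC0; rewrite -(addNr x) -scaleN1r; exact: Clin.
  apply: (Cmax [set 0]).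
    split=> [x /nC//|/(_ 0 erefl)/nC0//].
  split=> [a x y -> ->|u fu0]; first by rewrite /= scaler0 addr0.
  by apply: fi; rewrite (lin0 fl).
have CZ a x : C x -> C (a *: x) by move=> Cx; rewrite -[_ *: _]addr0; exact: Clin.
have CD x y : C x -> C y -> C (x + y).
  by move=> Cx Cy; rewrite -[x]scale1r; exact: Clin.
have CN x : C x -> C (- x) by move=> Cx; rewrite -scaleN1r; exact: CZ.
have dec v : exists u, C (v - f u).
  apply: contrapT => nv.
  pose D : set V := [set x | exists a c, C c /\ x = a *: v + c].
  apply: (Cmax D); split.
  - by move=> c Cc; exists 0, c; rewrite scale0r add0r.
  - move=> DC; apply: nv; exists 0; rewrite (lin0 fl) subr0; apply: DC.
    by exists 1, 0; rewrite scale1r addr0.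
  - move=> a x y [b [c [Cc ->]]] [b' [c' [Cc' ->]]].
    exists (a * b + b'), (a *: c + c'); split; first exact: Clin.
    by rewrite scalerDr scalerA scalerDl addrACA.
  - move=> u [a [c [Cc fu]]]; have [a0|a0] := eqVneq a 0.
      by move: fu; rewrite a0 scale0r add0r => fu; apply: C0; rewrite fu.
    case: nv; exists (a^-1 *: u); rewrite (linZ _ fl) fu scalerDr scalerA.
    by rewrite mulVf// scale1r opprD addrA subrr add0r; apply/CN/CZ.
have [g gP] := choice dec.
have uniq v u u' : C (v - f u) -> C (v - f u') -> u = u'.
  move=> Cu Cu'; apply/eqP; rewrite -subr_eq0; apply/eqP/C0.
  have -> : f (u - u') = (v - f u') - (v - f u).
    rewrite -scaleN1r (linD fl) (linZ _ fl) scaleN1r.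
    by rewrite opprB [RHS]addrC addrA subrK.
  exact/CD/CN.
exists g => [a x y|u]; last by apply: (uniq (f u)) => //; rewrite subrr.
apply: (uniq (a *: x + y)) => //; rewrite fl.
have -> : a *: x + y - (a *: f (g x) + f (g y)) =
          a *: (x - f (g x)) + (y - f (g y)).
  by rewrite scalerBr addrACA opprD.
exact: Clin.
Qed.

End Complement.

Lemma tmap_inj (k : fieldType) (V V' W W' : lmodType k)
    (f : V -> V') (g : W -> W') :
  linear f -> linear g -> injective f -> injective g -> injective (tmap f g).
Proof.
move=> fl gl /(lin_left_inverse fl)[f' f'l fK] /(lin_left_inverse gl)[g' g'l gK].
apply: (can_inj (g := tmap f' g')).
apply: (tens_eqlin (f := tmap f' g' \o tmap f g) (g := id)).
- by apply: lin_comp; exact: tmap_linear.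
- exact: lin_id.
- by move=> v w /=; rewrite !tmap_tens// fK gK.
Qed.

Import VectorInternalTheory.

Section TensorFinDim.
Variables (k : fieldType) (V W : vectType k).

Let toM : tensor V W -> 'M[k]_(dim V, dim W) :=
  tlift (fun (v : V) (w : W) => (v2r v)^T *m v2r w).
Let ofM (M : 'M[k]_(dim V, dim W)) : tensor V W :=
  \sum_i \sum_j M i j *: (r2v (delta_mx 0 i) ⊗ r2v (delta_mx 0 j)).

Let toM_bilin : bilin (fun (v : V) (w : W) => (v2r v)^T *m v2r w).
Proof.
split=> [w a v v'|v a w w'].
  by rewrite linearP [X in X *m _]linearP mulmxDl scalemxAl.
by rewrite linearP mulmxDr scalemxAr.
Qed.

Let toM_lin : linear toM. Proof. exact: tlift_linear toM_bilin. Qed.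

Let ofM_lin : linear ofM.
Proof.
move=> a M N; rewrite /ofM scaler_sumr -big_split; apply: eq_bigr => i _ /=.
rewrite scaler_sumr -big_split; apply: eq_bigr => j _ /=.
by rewrite !mxE scalerDl scalerA.
Qed.

Let lin_sum (X Y : lmodType k) (f : X -> Y) I (r : seq I) (F : I -> X) :
  linear f -> f (\sum_(i <- r) F i) = \sum_(i <- r) f (F i).
Proof.
by move=> fl; elim/big_ind2: _ => [|x1 x2 y1 y2 <- <-|//];
  rewrite ?(lin0 fl) ?(linD fl).
Qed.

Let toMK : cancel toM ofM.
Proof.
apply: (tens_eqlin (f := ofM \o toM) (g := id)); [exact: lin_comp|exact: lin_id|].
move=> v w /=; rewrite /toM tlift_tens// /ofM.
have vE : v = \sum_i v2r v 0 i *: r2v (delta_mx 0 i).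
  by rewrite -[LHS]v2rK {1}[v2r v]row_sum_delta linear_sum;
    apply: eq_bigr => i _; rewrite linearZ.
have wE : w = \sum_i v2r w 0 i *: r2v (delta_mx 0 i).
  by rewrite -[LHS]v2rK {1}[v2r w]row_sum_delta linear_sum;
    apply: eq_bigr => i _; rewrite linearZ.
rewrite [in RHS]vE (lin_sum _ _ (tens_linl w)); apply: eq_bigr => i _.
rewrite (linZ _ (tens_linl w)) [in RHS]wE (lin_sum _ _ (tens_linr _)).
rewrite scaler_sumr; apply: eq_bigr => j _.
by rewrite (linZ _ (tens_linr _)) scalerA mxE big_ord1 mxE.
Qed.

Let ofMK : cancel ofM toM.
Proof.
move=> M; rewrite /ofM (lin_sum _ _ toM_lin) [RHS]matrix_sum_delta.
apply: eq_bigr => i _; rewrite (lin_sum _ _ toM_lin); apply: eq_bigr => j _.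
rewrite (linZ _ toM_lin) /toM tlift_tens// !r2vK; congr (_ *: _).
by rewrite trmx_delta mul_delta_mx.
Qed.

Fact tensor_findim : vector_axiom_def (dim V * dim W) (tensor V W).
Proof.
exists (fun x => mxvec (toM x)).
  by move=> a x y; rewrite toM_lin linearP.
exists (fun r => ofM (vec_mx r)) => x; first by rewrite mxvecK toMK.
by rewrite ofMK vec_mxK.
Qed.

HB.instance Definition _ :=
  Lmodule_hasFinDim.Build k (tensor V W) tensor_findim.

End TensorFinDim.

(* The tensor algebra, presented as the free algebra on the set V modulo
   linearity of the generators. *)
Section TensorAlgebra.
Variables (k : fieldType) (V : lmodType k).

Inductive talg_term :=
| AGen of V
| AOne
| AMul of talg_term & talg_term
| AZero
| AAdd of talg_term & talg_term
| AScale of k & talg_term.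

Inductive talg_rel : talg_term -> talg_term -> Prop :=
| arel_refl x : talg_rel x x
| arel_sym x y of talg_rel x y : talg_rel y x
| arel_trans x y z of talg_rel x y & talg_rel y z : talg_rel x z
| arel_mul x x' y y' of talg_rel x x' & talg_rel y y' :
    talg_rel (AMul x y) (AMul x' y')
| arel_add x x' y y' of talg_rel x x' & talg_rel y y' :
    talg_rel (AAdd x y) (AAdd x' y')
| arel_scale a x x' of talg_rel x x' : talg_rel (AScale a x) (AScale a x')
| arel_addA x y z : talg_rel (AAdd x (AAdd y z)) (AAdd (AAdd x y) z)
| arel_addC x y : talg_rel (AAdd x y) (AAdd y x)
| arel_add0 x : talg_rel (AAdd AZero x) x
| arel_scaleA a b x : talg_rel (AScale a (AScale b x)) (AScale (a * b) x)
| arel_scale0 x : talg_rel (AScale 0 x) AZero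
| arel_scale1 x : talg_rel (AScale 1 x) x
| arel_scaleDr a x y :
    talg_rel (AScale a (AAdd x y)) (AAdd (AScale a x) (AScale a y))
| arel_scaleDl a b x :
    talg_rel (AScale (a + b) x) (AAdd (AScale a x) (AScale b x))
| arel_mulA x y z : talg_rel (AMul x (AMul y z)) (AMul (AMul x y) z)
| arel_mul1l x : talg_rel (AMul AOne x) x
| arel_mul1r x : talg_rel (AMul x AOne) x
| arel_mul_linl a x x' y :
    talg_rel (AMul (AAdd (AScale a x) x') y)
             (AAdd (AScale a (AMul x y)) (AMul x' y))
| arel_mul_linr a x y y' :
    talg_rel (AMul x (AAdd (AScale a y) y'))
             (AAdd (AScale a (AMul x y)) (AMul x y'))
| arel_gen_lin a v v' :
    talg_rel (AGen (a *: v + v')) (AAdd (AScale a (AGen v)) (AGen v')).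

HB.instance Definition _ := gen_eqMixin talg_term.
HB.instance Definition _ := gen_choiceMixin talg_term.

Definition talg_eqv (x y : talg_term) : bool := `[< talg_rel x y >].

Lemma talg_eqvP : equiv_class_of talg_eqv.
Proof.
split=> [x|x y|y x z].
- by apply/asboolP; exact: arel_refl.
- by apply/asboolP/asboolP; exact: arel_sym.
- by move=> /asboolP xy /asboolP yz; apply/asboolP; exact: arel_trans xy yz.
Qed.

Canonical talg_equiv := EquivRelPack talg_eqvP.

Definition talg := {eq_quot talg_equiv}.
HB.instance Definition _ := Choice.on talg.
HB.instance Definition _ := EqQuotient.on talg.

Lemma talg_piP x y : talg_rel x y <-> \pi_talg x = \pi_talg y.
Proof.
split=> [xy|/eqmodP/asboolP//]; exact/eqmodP/asboolP.
Qed.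

Lemma talg_reprP x : talg_rel (repr (\pi_talg x)) x.
Proof. by apply/talg_piP; rewrite reprK. Qed.

Definition tgen (v : V) : talg := \pi_talg (AGen v).
Definition talg_one : talg := \pi_talg AOne.
Definition talg_mul (x y : talg) : talg := \pi_talg (AMul (repr x) (repr y)).
Definition talg_zero : talg := \pi_talg AZero.
Definition talg_add (x y : talg) : talg := \pi_talg (AAdd (repr x) (repr y)).
Definition talg_scale a (x : talg) : talg := \pi_talg (AScale a (repr x)).

Lemma talg_mulE x y :
  talg_mul (\pi_talg x) (\pi_talg y) = \pi_talg (AMul x y).
Proof. by apply/talg_piP/arel_mul; exact: talg_reprP. Qed.

Lemma talg_addE x y :
  talg_add (\pi_talg x) (\pi_talg y) = \pi_talg (AAdd x y).
Proof. by apply/talg_piP/arel_add; exact: talg_reprP. Qed.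

Lemma talg_scaleE a x : talg_scale a (\pi_talg x) = \pi_talg (AScale a x).
Proof. by apply/talg_piP/arel_scale; exact: talg_reprP. Qed.

Lemma talg_ind_pi (P : talg -> Prop) :
  (forall x, P (\pi_talg x)) -> forall x, P x.
Proof. by move=> H x; rewrite -[x]reprK. Qed.

Fact talg_addA : associative talg_add.
Proof.
move=> x y z; elim/talg_ind_pi: x => x; elim/talg_ind_pi: y => y.
elim/talg_ind_pi: z => z; rewrite !talg_addE; exact/talg_piP/arel_addA.
Qed.

Fact talg_addC : commutative talg_add.
Proof.
move=> x y; elim/talg_ind_pi: x => x; elim/talg_ind_pi: y => y.
rewrite !talg_addE; exact/talg_piP/arel_addC.
Qed.

Fact talg_add0 : left_id talg_zero talg_add.
Proof.
elim/talg_ind_pi=> x; rewrite talg_addE; exact/talg_piP/arel_add0.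
Qed.

Fact talg_scaleDl x : {morph talg_scale^~ x : a b / a + b >-> talg_add a b}.
Proof.
move=> a b; elim/talg_ind_pi: x => x.
rewrite !talg_scaleE talg_addE; exact/talg_piP/arel_scaleDl.
Qed.

Fact talg_scale0 x : talg_scale 0 x = talg_zero.
Proof.
elim/talg_ind_pi: x => x; rewrite talg_scaleE; exact/talg_piP/arel_scale0.
Qed.

Fact talg_scale1 : left_id 1 talg_scale.
Proof.
elim/talg_ind_pi=> x; rewrite talg_scaleE; exact/talg_piP/arel_scale1.
Qed.

Fact talg_addN : left_inverse talg_zero (talg_scale (-1)) talg_add.
Proof.
move=> x; rewrite -{2}[x]talg_scale1 -talg_scaleDl addNr; exact: talg_scale0.
Qed.

HB.instance Definition _ :=
  GRing.isZmodule.Build talg talg_addA talg_addC talg_add0 talg_addN.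

Fact talg_scaleA a b x :
  talg_scale a (talg_scale b x) = talg_scale (a * b) x.
Proof.
elim/talg_ind_pi: x => x; rewrite !talg_scaleE; exact/talg_piP/arel_scaleA.
Qed.

Fact talg_scaleDr : right_distributive talg_scale +%R.
Proof.
move=> a; elim/talg_ind_pi=> x; elim/talg_ind_pi=> y.
rewrite /GRing.add /= !(talg_scaleE, talg_addE); exact/talg_piP/arel_scaleDr.
Qed.

HB.instance Definition _ := GRing.Zmodule_isLmodule.Build k talg
  talg_scaleA talg_scale1 talg_scaleDr talg_scaleDl.

Fact talg_mulA : associative talg_mul.
Proof.
move=> x y z; elim/talg_ind_pi: x => x; elim/talg_ind_pi: y => y.
elim/talg_ind_pi: z => z; rewrite !talg_mulE; exact/talg_piP/arel_mulA.
Qed.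

Fact talg_mul1l : left_id talg_one talg_mul.
Proof.
elim/talg_ind_pi=> x; rewrite talg_mulE; exact/talg_piP/arel_mul1l.
Qed.

Fact talg_mul1r : right_id talg_one talg_mul.
Proof.
elim/talg_ind_pi=> x; rewrite talg_mulE; exact/talg_piP/arel_mul1r.
Qed.

Fact talg_mul_linl y : linear (talg_mul^~ y).
Proof.
move=> a x x'; elim/talg_ind_pi: x => x; elim/talg_ind_pi: x' => x'.
elim/talg_ind_pi: y => y; rewrite /GRing.add /GRing.scale /=.
rewrite !(talg_scaleE, talg_addE, talg_mulE); exact/talg_piP/arel_mul_linl.
Qed.

Fact talg_mul_linr x : linear (talg_mul x).
Proof.
move=> a y y'; elim/talg_ind_pi: x => x; elim/talg_ind_pi: y' => y'.
elim/talg_ind_pi: y => y; rewrite /GRing.add /GRing.scale /=.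
rewrite !(talg_scaleE, talg_addE, talg_mulE); exact/talg_piP/arel_mul_linr.
Qed.

HB.instance Definition _ := Lmodule_isUAlgebra.Build k talg
  talg_mulA talg_mul1l talg_mul1r talg_mul_linl talg_mul_linr.

Lemma tgen_linear : linear tgen.
Proof.
move=> a v v'; rewrite /tgen /GRing.add /GRing.scale /= talg_scaleE talg_addE.
exact/talg_piP/arel_gen_lin.
Qed.

Lemma talg_ind (P : talg -> Prop) :
    (forall v, P (tgen v)) -> P 𝟙 ->
    (forall x y, P x -> P y -> P (x ⋅ y)) -> P 0 ->
    (forall x y, P x -> P y -> P (x + y)) ->
    (forall a x, P x -> P (a *: x)) ->
  forall x, P x.
Proof.
move=> Pg P1 PM P0 PD PZ; elim/talg_ind_pi.
elim=> [v||x Px y Py||x Px y Py|a x Px].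
- exact: Pg.
- exact: P1.
- by rewrite -talg_mulE; exact: PM.
- exact: P0.
- by rewrite -talg_addE; exact: PD.
- by rewrite -talg_scaleE; exact: PZ.
Qed.

Section Lift.
Variables (A : ualgType k) (f : V -> A).

Fixpoint talg_eval (x : talg_term) : A :=
  match x with
  | AGen v => f v
  | AOne => 𝟙
  | AMul x y => talg_eval x ⋅ talg_eval y
  | AZero => 0
  | AAdd x y => talg_eval x + talg_eval y
  | AScale a x => a *: talg_eval x
  end.

(* The algebra morphism extending f, for linear f. *)
Definition alift (x : talg) : A := talg_eval (repr x).

Hypothesis fl : linear f.

Lemma talg_eval_rel x y : talg_rel x y -> talg_eval x = talg_eval y.
Proof.
elim=> {x y} /=; do ?by [].
- by move=> ? ? ? _ -> _ ->.
- by move=> ? ? ? ? _ -> _ ->.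
- by move=> ? ? ? ? _ -> _ ->.
- by move=> ? ? ? _ ->.
- by move=> *; rewrite addrA.
- by move=> *; rewrite addrC.
- by move=> *; rewrite add0r.
- by move=> *; rewrite scalerA.
- by move=> *; rewrite scale0r.
- by move=> *; rewrite scale1r.
- by move=> *; rewrite scalerDr.
- by move=> *; rewrite scalerDl.
- by move=> *; rewrite amulA.
- by move=> *; rewrite amul1l.
- by move=> *; rewrite amul1r.
- by move=> *; rewrite amul_linl.
- by move=> *; rewrite amul_linr.
Qed.

Lemma alift_pi x : alift (\pi_talg x) = talg_eval x.
Proof. by apply: talg_eval_rel; exact: talg_reprP. Qed.

Lemma alift_gen v : alift (tgen v) = f v.
Proof. exact: alift_pi. Qed.

Lemma alift1 : alift 𝟙 = 𝟙.
Proof. exact: alift_pi. Qed.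

Lemma aliftM x y : alift (x ⋅ y) = alift x ⋅ alift y.
Proof.
elim/talg_ind_pi: x => x; elim/talg_ind_pi: y => y.
by rewrite [_ ⋅ _]talg_mulE !alift_pi.
Qed.

Lemma alift_linear : linear alift.
Proof.
move=> a; elim/talg_ind_pi=> x; elim/talg_ind_pi=> y.
by rewrite [_ *: _]talg_scaleE [_ + _]talg_addE !alift_pi.
Qed.

End Lift.

Definition tword (s : seq V) : talg := foldr (fun v x => tgen v ⋅ x) 𝟙 s.

(* The subspaces V^{⊗r} of the tensor algebra and V^{⊗r} ⊗ V^{⊗s} of its tensor
   square. *)
Definition tpow (r : nat) : set talg :=
  span (range (fun t : r.-tuple V => tword t)).

Definition tpow2 (r s : nat) : set (tensor talg talg) :=
  span [set x ⊗ y | x in tpow r & y in tpow s].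

End TensorAlgebra.

Arguments tpow {k} V r _.
Arguments tpow2 {k} V r s _.

Section GeneratedSubalgebra.
Variables (k : fieldType) (A : ualgType k) (S : set A).

Definition subalg_pred : pred A := fun x => `[< subalg S x >].

Fact subalg_pred_closed : submod_closed subalg_pred.
Proof.
split=> [|a x y].
  by apply/asboolP; rewrite -(scale0r (𝟙 : A)); apply: subalgZ; exact: subalg1.
move=> /asboolP Sx /asboolP Sy; apply/asboolP.
by apply: subalgD => //; exact: subalgZ.
Qed.

HB.instance Definition _ :=
  GRing.isSubmodClosed.Build k A subalg_pred subalg_pred_closed.

Definition subalg_type := {x : A | subalg_pred x}.
HB.instance Definition _ := SubChoice.on subalg_type.
HB.instance Definition _ := [SubChoice_isSubLmodule of subalg_type by <:].

Lemma subalg_valP (x : subalg_type) : subalg S (val x).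
Proof. by case: x => x /= /asboolP. Qed.

Definition subalg_mk x (Sx : subalg S x) : subalg_type :=
  exist _ x (asboolT Sx).

Definition subalg_one : subalg_type := subalg_mk (subalg1 S).
Definition subalg_mul (x y : subalg_type) : subalg_type :=
  subalg_mk (subalgM (subalg_valP x) (subalg_valP y)).

Fact subalg_mulA : associative subalg_mul.
Proof. by move=> x y z; apply: val_inj; rewrite /= amulA. Qed.

Fact subalg_mul1l : left_id subalg_one subalg_mul.
Proof. by move=> x; apply: val_inj; rewrite /= amul1l. Qed.

Fact subalg_mul1r : right_id subalg_one subalg_mul.
Proof. by move=> x; apply: val_inj; rewrite /= amul1r. Qed.

Fact subalg_mul_linl y : linear (subalg_mul^~ y).
Proof. by move=> a x x'; apply: val_inj; rewrite /= amul_linl. Qed.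

Fact subalg_mul_linr x : linear (subalg_mul x).
Proof. by move=> a y y'; apply: val_inj; rewrite /= amul_linr. Qed.

HB.instance Definition _ := Lmodule_isUAlgebra.Build k subalg_type
  subalg_mulA subalg_mul1l subalg_mul1r subalg_mul_linl subalg_mul_linr.

Lemma subalg_type_gen (S' : set subalg_type) :
  (forall x, S (val x) -> S' x) -> forall x, subalg S' x.
Proof.
move=> SS' x; have [y Sy yx] : exists2 y, subalg S y & val x = y.
  by exists (val x) => //; exact: subalg_valP.
elim: Sy x yx => {y} [|y Sy|y z Sy IHy Sz IHz|a y Sy IHy|y z Sy IHy Sz IHz] x yx.
- by have -> : x = 𝟙 by [apply: val_inj]; exact: subalg1.
- by apply/subalg_gen/SS'; rewrite yx.
- have -> : x = subalg_mk Sy + subalg_mk Sz by exact: val_inj.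
  by apply: subalgD; [exact: IHy|exact: IHz].
- have -> : x = a *: subalg_mk Sy by exact: val_inj.
  by apply: subalgZ; exact: IHy.
- have -> : x = subalg_mk Sy ⋅ subalg_mk Sz by exact: val_inj.
  by apply: subalgM; [exact: IHy|exact: IHz].
Qed.

End GeneratedSubalgebra.

(* The finite-dimensional subspace A_1 of A is given as a finite-dimensional
   space with an injective linear map to A. *)
Record quantum_space (k : fieldType) := QuantumSpace {
  qgen : vectType k;
  qalg : ualgType k;
  qinc : {linear qgen -> qalg};
  qinc_inj : injective qinc;
  qinc_gen : forall a : qalg, subalg (range qinc) a
}.

Definition is_qmor (k : fieldType) (A B : quantum_space k)
    (f : qalg A -> qalg B) : Prop :=
  [/\ linear f, f 𝟙 = 𝟙, {morph f : x y / x ⋅ y} &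
      f @` range (qinc A) `<=` range (qinc B)].

Definition qiso (k : fieldType) (A B : quantum_space k) : Prop :=
  exists (f : qalg A -> qalg B) (g : qalg B -> qalg A),
    [/\ is_qmor f, is_qmor g, cancel f g & cancel g f].

Section CanonicalEpi.
Variables (k : fieldType) (A : quantum_space k).

Definition qPi : talg (qgen A) -> qalg A := alift (qinc A).
Definition qPi2 : tensor (talg (qgen A)) (talg (qgen A)) ->
    tensor (qalg A) (qalg A) := tmap qPi qPi.

Lemma qPi_linear : linear qPi.
Proof. exact/alift_linear/linearP. Qed.

Lemma qPi_gen v : qPi (tgen v) = qinc A v.
Proof. exact/alift_gen/linearP. Qed.

Lemma qPi1 : qPi 𝟙 = 𝟙.
Proof. exact/alift1/linearP. Qed.

Lemma qPiM x y : qPi (x ⋅ y) = qPi x ⋅ qPi y.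
Proof. exact/aliftM/linearP. Qed.

Lemma qPi2_linear : linear qPi2.
Proof. by apply: tmap_linear; exact: qPi_linear. Qed.

Lemma qPi2_tens x y : qPi2 (x ⊗ y) = qPi x ⊗ qPi y.
Proof. by apply: tmap_tens; exact: qPi_linear. Qed.

Lemma qPi_surj a : exists x, qPi x = a.
Proof.
elim: (qinc_gen a) => {a} [|a [v _ <-]|a b _ [x <-] _ [y <-]|c a _ [x <-]|
                          a b _ [x <-] _ [y <-]].
- by exists 𝟙; exact: qPi1.
- by exists (tgen v); exact: qPi_gen.
- by exists (x + y); exact: (linD qPi_linear).
- by exists (c *: x); exact: (linZ _ qPi_linear).
- by exists (x ⋅ y); exact: qPiM.
Qed.

Lemma qPi2_surj a : exists x, qPi2 x = a.
Proof.
elim/tens_ind: a => [a b||a b [x <-] [y <-]|c a [x <-]].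
- have [[x <-] [y <-]] := (qPi_surj a, qPi_surj b).
  by exists (x ⊗ y); exact: qPi2_tens.
- by exists 0; exact: (lin0 qPi2_linear).
- by exists (x + y); exact: (linD qPi2_linear).
- by exists (c *: x); exact: (linZ _ qPi2_linear).
Qed.

End CanonicalEpi.

Section CircProduct.
Variables (k : fieldType) (A B : quantum_space k).

Definition circ_map : tensor (qgen A) (qgen B) -> tensor (qalg A) (qalg B) :=
  tmap (qinc A) (qinc B).

Lemma circ_map_linear : linear circ_map.
Proof. by apply: tmap_linear; exact: linearP. Qed.

Definition circ_alg := subalg_type (range circ_map).

Fact circ_inc_mem v : subalg (range circ_map) (circ_map v).
Proof. by apply: subalg_gen; exists v. Qed.

Definition circ_inc (v : tensor (qgen A) (qgen B)) : circ_alg :=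
  subalg_mk (circ_inc_mem v).

Fact circ_inc_linear : linear circ_inc.
Proof. by move=> a v w; apply: val_inj; exact: circ_map_linear. Qed.

HB.instance Definition _ := GRing.isLinear.Build k (tensor (qgen A) (qgen B))
  circ_alg _ circ_inc circ_inc_linear.

Fact circ_inc_inj : injective circ_inc.
Proof.
move=> v w /(congr1 val) /=; apply: tmap_inj; try exact: linearP.
- exact: qinc_inj.
- exact: qinc_inj.
Qed.

Fact circ_inc_gen (a : circ_alg) : subalg (range circ_inc) a.
Proof.
apply: subalg_type_gen => x [v _ vx]; exists v => //; exact: val_inj.
Qed.

Definition circ : quantum_space k := QuantumSpace circ_inc_inj circ_inc_gen.

End CircProduct.

Notation "A ∘ B" := (circ A B) (at level 40, left associativity).

Definition amult (k : fieldType) (A : ualgType k) : tensor A A -> A :=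
  tlift (fun x y => x ⋅ y).

Lemma amul_bilin (k : fieldType) (A : ualgType k) :
  bilin (fun x y : A => x ⋅ y).
Proof. by split=> a; [exact: amul_linl|exact: amul_linr]. Qed.

Lemma amult_linear (k : fieldType) (A : ualgType k) : linear (@amult k A).
Proof. exact/tlift_linear/amul_bilin. Qed.

Lemma amult_tens (k : fieldType) (A : ualgType k) (x y : A) :
  amult (x ⊗ y) = x ⋅ y.
Proof. exact/tlift_tens/amul_bilin. Qed.

Section Cochains.
Variables (k : fieldType) (V : lmodType k).
Let T2 := tensor (talg V) (talg V).

Definition cochain2 (psi : T2 -> T2) : Prop :=
  [/\ linear psi, bijective psi &
      forall r s, psi @` tpow2 V r s = tpow2 V r s].

(* On V^{⊗r+s}, identified with V^{⊗r} ⊗ V^{⊗s} by multiplication, psi_{r,s} is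
   [x ⋅ y |-> amult (psi (x ⊗ y))]. Both sides below are elements of
   V^{⊗r+s+t}. *)
Definition cocycle2 (psi : T2 -> T2) : Prop :=
  forall r s t x y z, tpow V r x -> tpow V s y -> tpow V t z ->
    amult (psi (amult (psi (x ⊗ y)) ⊗ z)) =
    amult (psi (x ⊗ amult (psi (y ⊗ z)))).

Definition counital (psi : T2 -> T2) : Prop :=
  forall a, psi (𝟙 ⊗ a) = 𝟙 ⊗ a /\ psi (a ⊗ 𝟙) = a ⊗ 𝟙.

Definition Z2 (psi : T2 -> T2) : Prop :=
  [/\ cochain2 psi, cocycle2 psi & counital psi].

End Cochains.

Section Homogeneous.
Variables (k : fieldType) (V : lmodType k).

Lemma tword_cat (s t : seq V) : tword (s ++ t) = tword s ⋅ tword t.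
Proof.
elim: s => [|v s IHs] /=; first by rewrite amul1l.
by rewrite IHs amulA.
Qed.

Lemma tpow_tword (s : seq V) : tpow V (size s) (tword s).
Proof. by apply: span_gen; exists (in_tuple s). Qed.

Lemma span_tword (x : talg V) : span (range (@tword k V)) x.
Proof.
elim/talg_ind: x => [v||x y Sx Sy||x y|a x].
- apply: span_gen; exists [:: v] => //=; exact: amul1r.
- by apply: span_gen; exists [::].
- elim: Sx => {x} [|_ [s _ <-]|x x' _ IHx _ IHx'|a x _ IHx].
  + rewrite (lin0 (amul_linl y)); exact: span0.
  + elim: Sy => {y} [|_ [t _ <-]|y y' _ IHy _ IHy'|a y _ IHy].
    * rewrite (lin0 (amul_linr _)); exact: span0.
    * by apply: span_gen; exists (s ++ t) => //; exact: tword_cat.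
    * by rewrite (linD (amul_linr _)); exact: spanD.
    * by rewrite (linZ _ (amul_linr _)); exact: spanZ.
  + by rewrite (linD (amul_linl y)); exact: spanD.
  + by rewrite (linZ _ (amul_linl y)); exact: spanZ.
- exact: span0.
- exact: spanD.
- exact: spanZ.
Qed.

Lemma talg_eqlin (X : lmodType k) (f g : talg V -> X) : linear f -> linear g ->
  (forall r x, tpow V r x -> f x = g x) -> f =1 g.
Proof.
move=> fl gl fg x; apply: (span_ind_lin fl gl _ (span_tword x)).
by move=> _ [s _ <-]; apply: fg; exact: tpow_tword.
Qed.

Lemma tpow0P x : tpow V 0 x -> exists a, x = a *: 𝟙.
Proof.
elim=> {x} [|_ [t _ <-]|_ _ _ [a ->] _ [b ->]|a _ _ [b ->]].
- by exists 0; rewrite scale0r.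
- by exists 1; rewrite tuple0 /= scale1r.
- by exists (a + b); rewrite scalerDl.
- by exists (a * b); rewrite scalerA.
Qed.

Lemma tpow1P x : tpow V 1 x -> exists v, x = tgen v.
Proof.
elim=> {x} [|_ [t _ <-]|_ _ _ [v ->] _ [w ->]|a _ _ [v ->]].
- by exists 0; rewrite (lin0 (@tgen_linear _ V)).
- case/tupleP: t => v t; exists v; rewrite tuple0 /=; exact: amul1r.
- by exists (v + w); rewrite (linD (@tgen_linear _ V)).
- by exists (a *: v); rewrite (linZ _ (@tgen_linear _ V)).
Qed.

Lemma tpowS x r : tpow V r.+1 x -> exists2 u, tpow2 V 1 r u & x = amult u.
Proof.
have ml := @amult_linear k (talg V).
elim=> {x} [|_ [t _ <-]|_ _ _ [u Hu ->] _ [w Hw ->]|a _ _ [u Hu ->]].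
- exists 0; [exact: span0|by rewrite (lin0 ml)].
- case/tupleP: t => v t; exists (tgen v ⊗ tword t); last by rewrite amult_tens.
  apply: span_gen; exists (tgen v).
    by have := tpow_tword [:: v]; rewrite /= amul1r.
  by exists (tword t) => //; have := tpow_tword t; rewrite size_tuple.
- by exists (u + w); [exact: spanD|rewrite (linD ml)].
- by exists (a *: u); [exact: spanZ|rewrite (linZ _ ml)].
Qed.

End Homogeneous.

Section Twisting.
Variables (k : fieldType) (A : quantum_space k).
Let T2 := tensor (talg (qgen A)) (talg (qgen A)).

Definition admissible (psi : T2 -> T2) : Prop :=
  psi @` [set x | qPi2 x = 0] = [set x | qPi2 x = 0 :> tensor (qalg A) (qalg A)].

(* The map Psi with [Psi \o qPi2 = qPi2 \o psi]; see [twPsiE]. *)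
Definition twPsi (psi : T2 -> T2) (a : tensor (qalg A) (qalg A)) :
    tensor (qalg A) (qalg A) :=
  qPi2 (psi (xget 0 [set x | qPi2 x = a])).

Definition twmul (psi : T2 -> T2) (a b : qalg A) : qalg A :=
  amult (twPsi psi (a ⊗ b)).

Variable psi : T2 -> T2.
Hypotheses (Zpsi : Z2 psi) (Apsi : admissible psi).

Let psil : linear psi. Proof. by case: Zpsi => - []. Qed.

Lemma twPsiE x : twPsi psi (qPi2 x) = qPi2 (psi x).
Proof.
rewrite /twPsi; set y := xget _ _.
have yx : [set z | qPi2 z = qPi2 x] y by apply: xgetPex; exists x.
have : [set x | qPi2 x = 0 :> tensor (qalg A) (qalg A)] (psi (-1 *: x + y)).
  rewrite -Apsi; exists (-1 *: x + y) => //=.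
  by rewrite qPi2_linear yx scaleN1r addNr.
rewrite /= psil qPi2_linear scaleN1r addrC => /eqP.
by rewrite subr_eq0 => /eqP.
Qed.

Lemma twPsi_linear : linear (twPsi psi).
Proof.
move=> a x y; have [[x' <-] [y' <-]] := (qPi2_surj x, qPi2_surj y).
by rewrite -qPi2_linear !twPsiE psil qPi2_linear.
Qed.

Lemma qPi_amult x : qPi (amult x) = amult (qPi2 x) :> qalg A.
Proof.
move: x; apply: tens_eqlin.
- by apply: lin_comp; [exact: qPi_linear|exact: amult_linear].
- by apply: lin_comp; [exact: amult_linear|exact: qPi2_linear].
- by move=> x y; rewrite qPi2_tens !amult_tens qPiM.
Qed.

Lemma twmulE x y : twmul psi (qPi x) (qPi y) = qPi (amult (psi (x ⊗ y))).
Proof. by rewrite /twmul -qPi2_tens twPsiE qPi_amult. Qed.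

Fact twmul_linl b : linear (twmul psi ^~ b).
Proof.
by move=> c a a'; rewrite /twmul tens_linl twPsi_linear amult_linear.
Qed.

Fact twmul_linr a : linear (twmul psi a).
Proof.
by move=> c b b'; rewrite /twmul tens_linr twPsi_linear amult_linear.
Qed.

Fact twmulA : associative (twmul psi).
Proof.
move=> a b c; have [[x <-] [y <-] [z <-]] := And3 (qPi_surj a) (qPi_surj b) (qPi_surj c).
have pl := @qPi_linear k A; have ml a' := twmul_linr a'.
have mr b' := twmul_linl b'.
move: x; apply: talg_eqlin.
- by move=> e x x'; rewrite pl mr.
- by move=> e x x'; rewrite pl mr [LHS]mr.
move=> r x Hx; move: y; apply: talg_eqlin.
- by move=> e y y'; rewrite pl mr [LHS]ml.
- by move=> e y y'; rewrite pl ml [LHS]mr.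
move=> s y Hy; move: z; apply: talg_eqlin.
- by move=> e z z'; rewrite pl !ml.
- by move=> e z z'; rewrite pl ml.
move=> t z Hz; rewrite !twmulE; congr qPi; apply/esym.
by case: Zpsi => _ + _; apply; [exact: Hx|exact: Hy|exact: Hz].
Qed.

Fact twmul1l : left_id 𝟙 (twmul psi).
Proof.
move=> a; have [x <-] := qPi_surj a; rewrite -qPi1 twmulE.
by case: Zpsi => _ _ /(_ x)[-> _]; rewrite amult_tens amul1l.
Qed.

Fact twmul1r : right_id 𝟙 (twmul psi).
Proof.
move=> a; have [x <-] := qPi_surj a; rewrite -qPi1 twmulE.
by case: Zpsi => _ _ /(_ x)[_ ->]; rewrite amult_tens amul1r.
Qed.

End Twisting.

Arguments admissible {k} A psi.

(* The vector space of A with the twisted product. *)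
Definition twalg (k : fieldType) (A : quantum_space k) psi
  (Zpsi : Z2 psi) (Apsi : admissible A psi) : Type := qalg A.

Section TwistedAlgebra.
Variables (k : fieldType) (A : quantum_space k).
Variable psi : tensor (talg (qgen A)) (talg (qgen A)) ->
  tensor (talg (qgen A)) (talg (qgen A)).
Hypotheses (Zpsi : Z2 psi) (Apsi : admissible A psi).

HB.instance Definition _ := GRing.Lmodule.on (twalg Zpsi Apsi).
HB.instance Definition _ := Lmodule_isUAlgebra.Build k (twalg Zpsi Apsi)
  (twmulA Zpsi Apsi) (twmul1l Zpsi Apsi) (twmul1r Zpsi Apsi)
  (twmul_linl Zpsi Apsi) (twmul_linr Zpsi Apsi).

Definition twinc (v : qgen A) : twalg Zpsi Apsi := qinc A v.

Fact twinc_linear : linear twinc.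
Proof. exact: linearP. Qed.

HB.instance Definition _ := GRing.isLinear.Build k (qgen A)
  (twalg Zpsi Apsi) _ twinc twinc_linear.

Fact twinc_inj : injective twinc.
Proof. exact: qinc_inj. Qed.

Fact twinc_gen (a : twalg Zpsi Apsi) : subalg (range twinc) a.
Proof.
have pl := @qPi_linear k A.
have S0 : subalg (range twinc) 0.
  by rewrite -(scale0r (𝟙 : twalg Zpsi Apsi)); apply: subalgZ; exact: subalg1.
have H r : forall x, tpow (qgen A) r x ->
    subalg (range twinc) (qPi x : twalg Zpsi Apsi).
  elim: r => [x /tpow0P[c ->]|r IHr x /tpowS[u Hu ->]].
    by rewrite (linZ _ pl) qPi1; apply: subalgZ; exact: subalg1.
  have [[psil _ psiT] _ _] := Zpsi.
  move: Hu; rewrite -(psiT 1%N r) => -[w Hw <-] {u}.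
  elim: Hw => {w} [|_ [y Hy [z Hz <-]]|v w _ IHv _ IHw|c v _ IHv].
  - by rewrite (lin0 psil) (lin0 (@amult_linear _ _)) (lin0 pl).
  - rewrite -(twmulE Zpsi Apsi); apply: subalgM; last exact: IHr.
    have [v ->] := tpow1P Hy; apply: subalg_gen; exists v => //.
    by rewrite qPi_gen.
  - by rewrite (linD psil) (linD (@amult_linear _ _)) (linD pl); exact: subalgD.
  - by rewrite (linZ _ psil) (linZ _ (@amult_linear _ _)) (linZ _ pl);
      exact: subalgZ.
have [x <-] := @qPi_surj k A a.
elim: (span_tword x) => {x} [|_ [s _ <-]|x y _ Hx _ Hy|c x _ Hx].
- by rewrite (lin0 pl).
- exact/H/tpow_tword.
- by rewrite (linD pl); exact: subalgD.
- by rewrite (linZ _ pl); exact: subalgZ.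
Qed.

Definition twist : quantum_space k := QuantumSpace twinc_inj twinc_gen.

End TwistedAlgebra.

Arguments twist {k} A {psi} Zpsi Apsi.

(* The canonical reordering on the (V ⊗ W)^{⊗r}: the algebra morphism extending
   [v ⊗ w |-> v ⊗ w]. *)
Definition unshuffle (k : fieldType) (V W : lmodType k) :
    talg (tensor V W) -> tensor (talg V) (talg W) :=
  alift (tmap (@tgen k V) (@tgen k W)).

Section WordLift.
Variables (k : fieldType) (V X : lmodType k).
Implicit Type f : seq V -> X.

Definition multilin f := forall s t a v w,
  f (s ++ (a *: v + w) :: t) = a *: f (s ++ v :: t) + f (s ++ w :: t).

Fixpoint word_eval f (x : talg_term V) : X :=
  match x with
  | AGen v => f [:: v]
  | AOne => f [::]
  | AMul x y => word_eval (fun s => word_eval (fun t => f (s ++ t)) y) x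
  | AZero => 0
  | AAdd x y => word_eval f x + word_eval f y
  | AScale a x => a *: word_eval f x
  end.

Lemma eq_word_eval f g x : f =1 g -> word_eval f x = word_eval g x.
Proof.
elim: x f g => [v||x IHx y IHy||x IHx y IHy|a x IHx] f g fg //=.
- by apply: IHx => s; apply: IHy => t.
- by rewrite (IHx f g)// (IHy f g).
- by rewrite (IHx f g).
Qed.

Lemma word_eval_lin a f g x :
  word_eval (fun s => a *: f s + g s) x = a *: word_eval f x + word_eval g x.
Proof.
elim: x f g => [v||x IHx y IHy||x IHx y IHy|b x IHx] f g //=.
- rewrite -IHx; apply: eq_word_eval => s; exact: IHy.
- by rewrite scaler0 addr0.
- by rewrite IHx IHy scalerDr addrACA.
- by rewrite IHx scalerDr !scalerA mulrC.
Qed.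

Lemma multilin_catl f s : multilin f -> multilin (fun t => f (s ++ t)).
Proof. by move=> fl t u a v w; rewrite !catA. Qed.

Lemma multilin_catr f y :
  multilin f -> multilin (fun s => word_eval (fun t => f (s ++ t)) y).
Proof.
move=> fl s t a v w; rewrite -word_eval_lin; apply: eq_word_eval => u.
by rewrite -!catA /= fl.
Qed.

Lemma word_eval_rel f x y :
  multilin f -> talg_rel x y -> word_eval f x = word_eval f y.
Proof.
move=> fl xy; elim: xy f fl => {x y} /=.
- by [].
- by move=> x y _ IH f fl; rewrite IH.
- by move=> x y z _ xy _ yz f fl; rewrite xy ?yz.
- move=> x x' y y' _ xx' _ yy' f fl; rewrite xx'; last exact: multilin_catr.
  by apply: eq_word_eval => s; apply: yy'; exact: multilin_catl.
- by move=> x x' y y' _ xx' _ yy' f fl; rewrite xx' ?yy'.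
- by move=> a x x' _ xx' f fl; rewrite xx'.
- by move=> *; rewrite addrA.
- by move=> *; rewrite addrC.
- by move=> *; rewrite add0r.
- by move=> *; rewrite scalerA.
- by move=> *; rewrite scale0r.
- by move=> *; rewrite scale1r.
- by move=> *; rewrite scalerDr.
- by move=> *; rewrite scalerDl.
- move=> x y z f fl; apply: eq_word_eval => s; apply: eq_word_eval => t.
  by apply: eq_word_eval => u; rewrite catA.
- by [].
- by move=> x f fl; apply: eq_word_eval => s; rewrite cats0.
- by [].
- by move=> a x y y' f fl; rewrite -word_eval_lin.
- by move=> a v v' f fl; exact: (fl [::] [::]).
Qed.

Definition wlift f (x : talg V) : X := word_eval f (repr x).

Lemma wlift_pi f x : multilin f -> wlift f (\pi_(talg V) x) = word_eval f x.
Proof. by move=> fl; apply: word_eval_rel => //; exact: talg_reprP. Qed.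

Lemma wlift_linear f : multilin f -> linear (wlift f).
Proof.
move=> fl a; elim/talg_ind_pi=> x; elim/talg_ind_pi=> y.
by rewrite [_ *: _]talg_scaleE [_ + _]talg_addE !wlift_pi.
Qed.

Lemma wlift_tword f s : multilin f -> wlift f (tword s) = f s.
Proof.
move=> fl; have -> : tword s =
    \pi_(talg V) (foldr (fun v x => AMul (AGen v) x) (AOne V) s).
  by elim: s => //= v s ->; exact: talg_mulE.
rewrite wlift_pi//; elim: s f fl => //= v s IHs f fl.
by rewrite IHs//; exact: (multilin_catl [:: v]).
Qed.

End WordLift.

Section Reordering.
Variables (k : fieldType) (V W : lmodType k).
Let TV := talg V.
Let TW := talg W.
Let TVW := talg (tensor V W).

Fixpoint tzip (s : seq V) (t : seq W) : TVW :=
  match s, t with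
  | [::], [::] => 𝟙
  | v :: s, w :: t => tgen (v ⊗ w) ⋅ tzip s t
  | _, _ => 0
  end.

Lemma tzip_multilinl t : multilin (tzip^~ t).
Proof.
move=> s u a v v'; elim: s t => [|x s IHs] [|w t] /=.
- by rewrite scaler0 addr0.
- by rewrite tens_linl tgen_linear amul_linl.
- by rewrite scaler0 addr0.
- by rewrite IHs amul_linr.
Qed.

Lemma tzip_multilinr s : multilin (tzip s).
Proof.
move=> t u a w w'; elim: t s => [|x t IHt] [|v s] /=.
- by rewrite scaler0 addr0.
- by rewrite tens_linr tgen_linear amul_linl.
- by rewrite scaler0 addr0.
- by rewrite IHt amul_linr.
Qed.

Lemma wlift_tzip_multilin (y : TW) :
  multilin (fun s => wlift (tzip s) y).
Proof.
move=> s t a v w; rewrite -word_eval_lin; apply: eq_word_eval => u.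
exact: tzip_multilinl.
Qed.

Definition shuffle : tensor TV TW -> TVW :=
  tlift (fun x y => wlift (fun s => wlift (tzip s) y) x).

Lemma shuffle_bilin :
  bilin (fun (x : TV) (y : TW) => wlift (fun s => wlift (tzip s) y) x).
Proof.
split=> [y|x a y y']; first exact/wlift_linear/wlift_tzip_multilin.
rewrite -word_eval_lin; apply: eq_word_eval => s.
exact/wlift_linear/tzip_multilinr.
Qed.

Lemma shuffle_linear : linear shuffle.
Proof. exact/tlift_linear/shuffle_bilin. Qed.

Lemma shuffle_tword s t : shuffle (tword s ⊗ tword t) = tzip s t.
Proof.
rewrite /shuffle tlift_tens; last exact: shuffle_bilin.
rewrite wlift_tword; last exact: wlift_tzip_multilin.
rewrite wlift_tword//; exact: tzip_multilinr.
Qed.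

Let gens_linear : linear (tmap (@tgen k V) (@tgen k W)).
Proof. by apply: tmap_linear; exact: tgen_linear. Qed.

Lemma unshuffle_linear : linear (@unshuffle k V W).
Proof. exact: alift_linear. Qed.

Lemma unshuffle_tzip s t : size s = size t ->
  unshuffle (tzip s t) = tword s ⊗ tword t.
Proof.
elim: s t => [|v s IHs] [|w t] //=; first by rewrite /unshuffle alift1.
move=> [/IHs {}IHs]; rewrite /unshuffle aliftM// alift_gen//.
rewrite tmap_tens; [|exact: tgen_linear|exact: tgen_linear].
rewrite -/(unshuffle _) IHs; exact: tens_mulE.
Qed.

Definition zip_words r : set TVW :=
  [set x | exists s t, [/\ size s = r, size t = r & x = tzip s t]].

Lemma tpow_tzip r x : tpow (tensor V W) r x -> span (zip_words r) x.
Proof.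
elim: r x => [|r IHr] x.
  move=> /tpow0P[a ->]; apply/spanZ/span_gen; by exists [::], [::].
move=> /tpowS[u Hu ->] {x}.
have ml := @amult_linear k TVW.
elim: Hu => {u} [|_ [_ /tpow1P[v ->] [z /IHr Hz <-]]|x y _ Hx _ Hy|a x _ Hx].
- by rewrite (lin0 ml); exact: span0.
- rewrite amult_tens.
  elim/tens_ind: v => [v w||x y Hx Hy|a x Hx].
  + elim: Hz => {z} [|_ [s [t [sr tr ->]]]|x y _ Hx _ Hy|a x _ Hx].
    * by rewrite (lin0 (amul_linr _)); exact: span0.
    * by apply: span_gen; exists (v :: s), (w :: t); rewrite /= sr tr.
    * by rewrite (linD (amul_linr _)); exact: spanD.
    * by rewrite (linZ _ (amul_linr _)); exact: spanZ.
  + rewrite (lin0 (@tgen_linear k _)) (lin0 (amul_linl _)); exact: span0.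
  + rewrite (linD (@tgen_linear k _)) (linD (amul_linl _)); exact: spanD.
  + rewrite (linZ _ (@tgen_linear k _)) (linZ _ (amul_linl _)); exact: spanZ.
- by rewrite (linD ml); exact: spanD.
- by rewrite (linZ _ ml); exact: spanZ.
Qed.

Lemma unshuffleK : cancel (@unshuffle k V W) shuffle.
Proof.
apply: talg_eqlin.
- by apply: lin_comp; [exact: shuffle_linear|exact: unshuffle_linear].
- exact: lin_id.
move=> r x /tpow_tzip; move: x; apply: span_ind_lin.
- by apply: lin_comp; [exact: shuffle_linear|exact: unshuffle_linear].
- exact: lin_id.
move=> _ [s [t [sr tr ->]]] /=.
by rewrite unshuffle_tzip ?sr ?tr// shuffle_tword.
Qed.

End Reordering.

Section Interchange.
Variables (k : fieldType) (E F G H : lmodType k).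

(* [(a ⊗ b) ⊗ (c ⊗ d) |-> (a ⊗ c) ⊗ (b ⊗ d)] *)
Definition interchange : tensor (tensor E F) (tensor G H) ->
    tensor (tensor E G) (tensor F H) :=
  tlift (fun x y => tlift (fun a b => tmap (tens a) (tens b) y) x).

Let L (a : E) (b : F) := tmap_linear (@tens_linr k E G a) (@tens_linr k F H b).
Let T (a : E) (b : F) c d :=
  tmap_tens c d (@tens_linr k E G a) (@tens_linr k F H b).

Let bilin1 y : bilin (fun (a : E) (b : F) =>
  tmap (tens a) (tens b) y : tensor (tensor E G) (tensor F H)).
Proof.
split=> [b e a a'|a e b b'].
  elim/tens_ind: y => [v w||x y Hx Hy|d x Hx].
  - by rewrite !T !tens_linl.
  - by rewrite !(lin0 (L _ _)) scaler0 addr0.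
  - by rewrite !(linD (L _ _)) Hx Hy scalerDr addrACA.
  - by rewrite !(linZ _ (L _ _)) Hx scalerDr !scalerA mulrC.
elim/tens_ind: y => [v w||x y Hx Hy|d x Hx].
- by rewrite !T tens_linl tens_linr.
- by rewrite !(lin0 (L _ _)) scaler0 addr0.
- by rewrite !(linD (L _ _)) Hx Hy scalerDr addrACA.
- by rewrite !(linZ _ (L _ _)) Hx scalerDr !scalerA mulrC.
Qed.

Let bilin2 : bilin (fun (x : tensor E F) (y : tensor G H) =>
  tlift (fun a b => tmap (tens a) (tens b) y) x
    : tensor (tensor E G) (tensor F H)).
Proof.
split=> [y|x e y y']; first exact/tlift_linear/bilin1.
elim/tens_ind: x => [a b||x x' Hx Hx'|d x Hx].
- by rewrite !tlift_tens// L.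
- by rewrite !(lin0 (tlift_linear (bilin1 _))) scaler0 addr0.
- by rewrite !(linD (tlift_linear (bilin1 _))) Hx Hx' scalerDr addrACA.
- by rewrite !(linZ _ (tlift_linear (bilin1 _))) Hx scalerDr !scalerA mulrC.
Qed.

Lemma interchange_linear : linear interchange.
Proof. exact: tlift_linear bilin2. Qed.

Lemma interchange_tens a b c d :
  interchange ((a ⊗ b) ⊗ (c ⊗ d)) = (a ⊗ c) ⊗ (b ⊗ d).
Proof. by rewrite /interchange tlift_tens// tlift_tens. Qed.

End Interchange.

Lemma interchangeK (k : fieldType) (E F G H : lmodType k) :
  cancel (@interchange k E F G H) (@interchange k E G F H).
Proof.
have l := lin_comp (@interchange_linear k E G F H) (@interchange_linear k E F G H).
apply: (tens_eqlin l (@lin_id _ _)) => x y /=.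
move: x; apply: tens_eqlin.
- by move=> e x x'; rewrite tens_linl; exact: l.
- by move=> e x x'; rewrite tens_linl.
move=> a b; move: y; apply: tens_eqlin.
- by move=> e x x'; rewrite tens_linr; exact: l.
- by move=> e x x'; rewrite tens_linr.
by move=> c d; rewrite !interchange_tens.
Qed.

Section ExternalProduct.
Variables (k : fieldType) (V W : lmodType k).
Let TV := talg V.
Let TW := talg W.
Let TVW := talg (tensor V W).

(* Restricted to (V ⊗ W)^{⊗r} ⊗ (V ⊗ W)^{⊗s}, the canonical reordering
   isomorphism onto (V^{⊗r} ⊗ V^{⊗s}) ⊗ (W^{⊗r} ⊗ W^{⊗s}). *)
Definition unshuffle2 (x : tensor TVW TVW) :
    tensor (tensor TV TV) (tensor TW TW) :=
  interchange (tmap (@unshuffle k V W) (@unshuffle k V W) x).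

(* Transport of [tmap psi phi] along [unshuffle2]: for cochains psi and phi, the
   y below exists ([jmapE]) and is unique ([unshuffle2_inj]). *)
Definition jmap (psi : tensor TV TV -> tensor TV TV)
    (phi : tensor TW TW -> tensor TW TW) (x : tensor TVW TVW) :
    tensor TVW TVW :=
  xget 0 [set y | unshuffle2 y = tmap psi phi (unshuffle2 x)].

Lemma unshuffle2_linear : linear unshuffle2.
Proof.
apply: lin_comp; first exact: interchange_linear.
by apply: tmap_linear; exact: unshuffle_linear.
Qed.

Lemma unshuffle2_inj : injective unshuffle2.
Proof.
apply: inj_comp; first exact: can_inj (@interchangeK _ _ _ _ _).
by apply: tmap_inj; try exact: unshuffle_linear; exact: can_inj (@unshuffleK _ _ _).
Qed.

Let image r s : set (tensor (tensor TV TV) (tensor TW TW)) :=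
  unshuffle2 @` tpow2 (tensor V W) r s.

Let imageP r s p q : tpow2 V r s p -> tpow2 W r s q -> image r s (p ⊗ q).
Proof.
have D x y : image r s x -> image r s y -> image r s (x + y).
  move=> [x' ? <-] [y' ? <-]; exists (x' + y'); first exact: spanD.
  exact: (linD unshuffle2_linear).
have Z a x : image r s x -> image r s (a *: x).
  move=> [x' ? <-]; exists (a *: x'); first exact: spanZ.
  exact: (linZ _ unshuffle2_linear).
have O : image r s 0.
  by exists 0; [exact: span0|exact: (lin0 unshuffle2_linear)].
have S (X : lmodType k) (S : set X) (f : X -> tensor (tensor TV TV) (tensor TW TW)) :
    linear f -> (forall x, S x -> image r s (f x)) ->
    forall x, span S x -> image r s (f x).
  move=> fl fS x; elim=> {x} [|x Sx|x y _ Hx _ Hy|a x _ Hx].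
  - by rewrite (lin0 fl).
  - exact: fS.
  - by rewrite (linD fl); exact: D.
  - by rewrite (linZ _ fl); exact: Z.
move=> Hp Hq; move: p Hp; apply: (S _ _ _ (tens_linl q)) => _ [a Ha [c Hc <-]].
move: q Hq; apply: (S _ _ _ (tens_linr _)) => _ [b Hb [d Hd <-]].
move: a Ha; apply: (S _ _ (fun a => (a ⊗ c) ⊗ (b ⊗ d))) => [e x x'|_ [a _ <-]].
  by rewrite !tens_linl.
move: c Hc; apply: (S _ _ (fun c => (_ ⊗ c) ⊗ (b ⊗ d))) => [e x x'|_ [c _ <-]].
  by rewrite tens_linr tens_linl.
move: b Hb; apply: (S _ _ (fun b => _ ⊗ (b ⊗ d))) => [e x x'|_ [b _ <-]].
  by rewrite tens_linl tens_linr.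
move: d Hd; apply: (S _ _ (fun d => _ ⊗ (_ ⊗ d))) => [e x x'|_ [d _ <-]].
  by rewrite !tens_linr.
exists (tzip a b ⊗ tzip c d); last first.
  rewrite /unshuffle2 tmap_tens; try exact: unshuffle_linear.
  by rewrite !unshuffle_tzip ?size_tuple// interchange_tens.
apply: span_gen.
have H n (s1 : n.-tuple V) (s2 : n.-tuple W) : tpow (tensor V W) n (tzip s1 s2).
  have -> : tzip s1 s2 = tword [seq u.1 ⊗ u.2 | u <- zip s1 s2].
    elim: n s1 s2 => [|n IHn] s1 s2; first by rewrite (tuple0 s1) (tuple0 s2).
    by case/tupleP: s1 => v s1; case/tupleP: s2 => w s2 /=; rewrite IHn.
  have := tpow_tword [seq u.1 ⊗ u.2 | u <- zip s1 s2].
  by rewrite size_map size_zip !size_tuple minnn.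
by exists (tzip a b); [exact: H|exists (tzip c d); [exact: H|]].
Qed.

Lemma jmapE psi phi : cochain2 psi -> cochain2 phi ->
  forall x, unshuffle2 (jmap psi phi x) = tmap psi phi (unshuffle2 x).
Proof.
move=> [psil _ psiT] [phil _ phiT] x.
have l := tmap_linear psil phil.
suff [y Hy] : exists y, unshuffle2 y = tmap psi phi (unshuffle2 x).
  have : [set y | unshuffle2 y = tmap psi phi (unshuffle2 x)] (jmap psi phi x).
    by apply: xgetPex; exists y.
  by [].
have D p q : (exists y, unshuffle2 y = tmap psi phi (unshuffle2 p)) ->
    (exists y, unshuffle2 y = tmap psi phi (unshuffle2 q)) ->
    exists y, unshuffle2 y = tmap psi phi (unshuffle2 (p + q)).
  move=> [p' Hp] [q' Hq]; exists (p' + q').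
  by rewrite !(linD unshuffle2_linear) Hp Hq (linD l).
have Z a p : (exists y, unshuffle2 y = tmap psi phi (unshuffle2 p)) ->
    exists y, unshuffle2 y = tmap psi phi (unshuffle2 (a *: p)).
  move=> [p' Hp]; exists (a *: p').
  by rewrite !(linZ _ unshuffle2_linear) Hp (linZ _ l).
have O : exists y, unshuffle2 y = tmap psi phi (unshuffle2 0).
  by exists 0; rewrite (lin0 unshuffle2_linear) (lin0 l).
elim/tens_ind: x => [x y||x y|a x]; [|exact: O|exact: D|exact: Z].
elim: (span_tword x) => {x} [|_ [s' _ <-]|x x' _ Hx _ Hx'|a x _ Hx].
- by rewrite (lin0 (tens_linl y)).
- move: (tpow_tzip (tpow_tword s')); move: (size s') (tword s') => r p.
  elim=> {p} [|_ [s [t [sr tr ->]]]|x x' _ Hx _ Hx'|a x _ Hx].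
  + by rewrite (lin0 (tens_linl y)).
  + elim: (span_tword y) => {y} [|_ [u' _ <-]|x x' _ Hx _ Hx'|a x _ Hx].
    * by rewrite (lin0 (tens_linr _)).
    * move: (tpow_tzip (tpow_tword u')); move: (size u') (tword u') => r' q.
      elim=> {q} [|_ [s1 [t1 [s1r t1r ->]]]|x x' _ Hx _ Hx'|a x _ Hx].
      -- by rewrite (lin0 (tens_linr _)).
      -- have ul := @unshuffle_linear k V W.
         rewrite /unshuffle2 (tmap_tens _ _ ul ul) !unshuffle_tzip ?sr ?s1r//.
         rewrite interchange_tens (tmap_tens _ _ psil phil).
         have Tw (U : lmodType k) (p q : seq U) :
             tpow2 U (size p) (size q) (tword p ⊗ tword q).
           by apply: span_gen; exists (tword p); [exact: tpow_tword|];
             exists (tword q); [exact: tpow_tword|].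
         have ex_a : tpow2 V (size s) (size s1) (psi (tword s ⊗ tword s1)).
           by rewrite -psiT; exists (tword s ⊗ tword s1) => //; exact: Tw.
         have ex_b : tpow2 W (size s) (size s1) (phi (tword t ⊗ tword t1)).
           rewrite sr s1r -tr -t1r -phiT.
           by exists (tword t ⊗ tword t1) => //; exact: Tw.
         have [y _ Hy] := @imageP (size s) (size s1) _ _ ex_a ex_b.
         by exists y.
      -- by rewrite (linD (tens_linr _)); exact: D.
      -- by rewrite (linZ _ (tens_linr _)); exact: Z.
    * by rewrite (linD (tens_linr _)); exact: D.
    * by rewrite (linZ _ (tens_linr _)); exact: Z.
  + by rewrite (linD (tens_linl _)); exact: D.
  + by rewrite (linZ _ (tens_linl _)); exact: Z.
- by rewrite (linD (tens_linl _)); exact: D.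
- by rewrite (linZ _ (tens_linl _)); exact: Z.
Qed.

End ExternalProduct.

(* Main.v *)
Require Import Defs.
From HB Require Import structures.
From mathcomp Require Import all_boot all_order all_algebra.
From mathcomp Require Import boolp classical_sets reals complex.

(** Everything rests on the reordering map
    u : T(V ⊗ W) -> T(V) ⊗ T(W), sending v ⊗ w to v ⊗ w ([unshuffle]). It is an
    injective algebra morphism, and the product of two elements x, y of T(V) ⊗
    T(W) is obtained from x ⊗ y by interchanging the middle factors and then
    multiplying in T(V) and in T(W) ([tens_amulE]). The cochain j(psi, phi) is
    psi ⊗ phi conjugated by the corresponding reordering of tensor squares.

    Cochain. The reordering of squares has the explicit left inverse
    [shuffle2], and it identifies the bidegree (r, s) part with the tensor
    product of the bidegree (r, s) parts for V and for W. So j(psi, phi) is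
    linear and preserves bidegrees; its inverse is j(psi^-1, phi^-1), which has
    the same properties ([jmap_cochain2]).

    Cocycle. A counital 2-cocycle psi is exactly what makes
    x * y = m(psi(x ⊗ y)) an associative unital product on T(V); call the
    resulting algebra T(V)_psi ([ttwist]). For the product twisted by
    j(psi, phi), the injection u becomes multiplicative towards the algebra
    T(V)_psi ⊗ T(W)_phi ([unshuffle_ttwist]), so associativity there gives the
    cocycle identity for j(psi, phi) ([jmap_Z2]).

    Admissibility. The canonical map of A ∘ B, followed by the inclusion into
    A ⊗ B, is Pi_A ⊗ Pi_B after u ([circ_val_qPi]). On tensor squares,
    j(psi, phi) therefore corresponds to Psi ⊗ Phi, where Psi and Phi are the
    maps induced on A ⊗ A and B ⊗ B ([circ_val2_jmap]). These are injective, so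
    j(psi, phi) preserves the kernel in both directions ([jmap_admissible]).

    Isomorphism. Both quantum spaces embed in the algebra A_psi ⊗ B_phi: the
    product A_psi ∘ B_phi by definition, and the twisting of A ∘ B because the
    inclusion of A ∘ B in A ⊗ B is multiplicative for the twisted products;
    this is checked on images of T(A_1 ⊗ B_1), where it is the
    multiplicativity of u, Pi_A and Pi_B ([twist_circ_val_embedding]). The
    generators have the same image A_1 ⊗ B_1, so the images of the two
    embeddings are the same generated subalgebra ([qiso_embeddings]). *)

Set Implicit Arguments.
Unset Strict Implicit.
Unset Printing Implicit Defensive.

Import GRing.Theory.
Local Open Scope ring_scope.
Local Open Scope classical_set_scope.

Local Notation span := Defs.span.
Local Notation interchange := Defs.interchange.

(** * Linear and bilinear maps *)

Section Spans.
Variables (k : fieldType) (U V : lmodType k).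

Lemma span_lin (S : set U) (T : set V) (f : U -> V) : linear f ->
  (forall x, S x -> span T (f x)) -> forall x, span S x -> span T (f x).
Proof.
move=> fl ST x; elim=> {x} [|x /ST//|x y _ Hx _ Hy|a x _ Hx].
- by rewrite (lin0 fl); exact: span0.
- by rewrite (linD fl); exact: spanD.
- by rewrite (linZ _ fl); exact: spanZ.
Qed.

Lemma tens_bilin : bilin (@tens k U V).
Proof. by split=> ?; [exact: tens_linl|exact: tens_linr]. Qed.

End Spans.

Lemma span_bilin (k : fieldType) (U V X : lmodType k)
    (S : set U) (T : set V) (Q : set X) (f : U -> V -> X) : bilin f ->
  (forall x y, S x -> T y -> span Q (f x y)) ->
  forall x y, span S x -> span T y -> span Q (f x y).
Proof.
move=> [fl fr] STQ x y Sx Ty; move: x Sx.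
apply: (span_lin (f := f^~ y)) => // x Sx; move: y Ty.
by apply: (span_lin (f := f x)) => // y; exact: STQ.
Qed.

Lemma bilin_comp (k : fieldType) (U V X Y : lmodType k)
    (f : U -> V -> X) (g : X -> Y) :
  linear g -> bilin f -> bilin (fun x y => g (f x y)).
Proof. by move=> gl [fl fr]; split=> z a x y /=; rewrite ?fl ?fr gl. Qed.

Section TensorMaps.
Variables (k : fieldType).

Lemma tmap_comp (U U' U'' V V' V'' : lmodType k)
    (f : U -> U') (f' : U' -> U'') (g : V -> V') (g' : V' -> V'') :
  linear f -> linear f' -> linear g -> linear g' ->
  forall x, tmap f' g' (tmap f g x) = tmap (f' \o f) (g' \o g) x.
Proof.
move=> fl fl' gl gl'; have fll := lin_comp fl' fl; have gll := lin_comp gl' gl.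
apply: (tens_eqlin (f := tmap f' g' \o tmap f g)).
- by apply: lin_comp; exact: tmap_linear.
- exact: tmap_linear.
- by move=> u v /=; rewrite !tmap_tens.
Qed.

Lemma eq_tmap (U U' V V' : lmodType k) (f f' : U -> U') (g g' : V -> V') :
  f =1 f' -> g =1 g' -> tmap f g =1 tmap f' g'.
Proof. by move=> /funext-> /funext->. Qed.

Lemma interchange_tmap (E F G H E' F' G' H' : lmodType k)
    (e : E -> E') (f : F -> F') (g : G -> G') (h : H -> H') :
  linear e -> linear f -> linear g -> linear h ->
  forall x, interchange (tmap (tmap e f) (tmap g h) x) =
            tmap (tmap e g) (tmap f h) (interchange x).
Proof.
move=> el fl gl hl.
have efl := tmap_linear el fl; have ghl := tmap_linear gl hl.
have egl := tmap_linear el gl; have fhl := tmap_linear fl hl.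
have Il := @Defs.interchange_linear k.
have Ll : linear (@Defs.interchange k E' F' G' H' \o tmap (tmap e f) (tmap g h)).
  exact: lin_comp (Il _ _ _ _) (tmap_linear efl ghl).
have Lr : linear (tmap (tmap e g) (tmap f h) \o @Defs.interchange k E F G H).
  exact: lin_comp (tmap_linear egl fhl) (Il _ _ _ _).
apply: (tens_eqlin Ll Lr) => y z; move: y.
apply: tens_eqlin => [a y y'|a y y'|a b].
- by rewrite tens_linl Ll.
- by rewrite tens_linl Lr.
move: z; apply: tens_eqlin => [s z z'|s z z'|c d].
- by rewrite tens_linr Ll.
- by rewrite tens_linr Lr.
by rewrite /= !(tmap_tens, interchange_tens).
Qed.

Lemma amul_tens (A B : ualgType k) (a a' : A) (b b' : B) :
  (a ⊗ b) ⋅ (a' ⊗ b') = (a ⋅ a') ⊗ (b ⋅ b').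
Proof. exact: tens_mulE. Qed.

(** Writing the product of a tensor product of algebras in terms of [interchange]
    is what relates it to [unshuffle2], and hence to [jmap]. *)
Lemma tens_amulE (A B : ualgType k) (x y : tensor A B) :
  x ⋅ y = tmap (@amult k A) (@amult k B) (interchange (x ⊗ y)).
Proof.
have ml (C : ualgType k) := @amult_linear k C.
have L : linear (tmap (@amult k A) (@amult k B) \o @Defs.interchange k A B A B).
  exact: lin_comp (tmap_linear (ml A) (ml B)) (@interchange_linear _ _ _ _ _).
move: x; apply: tens_eqlin => [|c x x'|a b]; first exact: amul_linl.
  by rewrite tens_linl; exact: L.
move: y; apply: tens_eqlin => [|c y y'|c d]; first exact: amul_linr.
  by rewrite tens_linr; exact: L.
by rewrite interchange_tens (tmap_tens _ _ (ml A) (ml B)) !amult_tens amul_tens.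
Qed.

Lemma tmapM (A B A' B' : ualgType k) (f : A -> A') (g : B -> B') :
  linear f -> linear g -> {morph f : x y / x ⋅ y} -> {morph g : x y / x ⋅ y} ->
  {morph tmap f g : x y / x ⋅ y}.
Proof.
move=> fl gl fM gM x y; have L := tmap_linear fl gl.
move: x; apply: tens_eqlin => [c x x'|c x x'|a b].
- by rewrite amul_linl L.
- by rewrite L amul_linl.
move: y; apply: tens_eqlin => [s y y'|s y y'|c d].
- by rewrite amul_linr L.
- by rewrite L amul_linr.
by rewrite amul_tens !tmap_tens// amul_tens fM gM.
Qed.

End TensorMaps.

(** * The external product of cochains *)

Lemma cochain2_inv (k : fieldType) (V : lmodType k)
    (psi : tensor (talg V) (talg V) -> tensor (talg V) (talg V)) :
  cochain2 psi -> exists psi', [/\ cochain2 psi', cancel psi psi' & cancel psi' psi].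
Proof.
move=> [psil [psi' psiK psi'K] psiT]; exists psi'; split=> //; split=> [a x y||r s].
- by apply: (can_inj psiK); rewrite psil !psi'K.
- by exists psi.
rewrite -[in LHS](psiT r s); apply/seteqP; split=> [_ [_ [x Hx <-] <-]|x Hx].
  by rewrite psiK.
by exists (psi x); [exists x|rewrite psiK].
Qed.

Section ExternalProduct.
Variables (k : fieldType) (V W : lmodType k).
Local Notation TV := (talg V).
Local Notation TW := (talg W).
Local Notation TVW := (talg (tensor V W)).

(** The inverse of [unshuffle2] on the image of the latter. *)
Definition shuffle2 (x : tensor (tensor TV TV) (tensor TW TW)) : tensor TVW TVW :=
  tmap (@shuffle k V W) (@shuffle k V W) (interchange x).

Lemma shuffle2_linear : linear shuffle2.
Proof.
apply: lin_comp; last exact: interchange_linear.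
by apply: tmap_linear; exact: shuffle_linear.
Qed.

Lemma unshuffle2K : cancel (@unshuffle2 k V W) shuffle2.
Proof.
have sl := @shuffle_linear k V W; have ul := @unshuffle_linear k V W.
move=> x; rewrite /shuffle2 /unshuffle2 interchangeK tmap_comp//.
move: x; apply: tens_eqlin => [||x y]; [|exact: lin_id|].
  by apply: tmap_linear; exact: lin_comp.
by rewrite tmap_tens /= ?unshuffleK//; exact: lin_comp.
Qed.

(** The image of the bidegree (r, s) part under [unshuffle2]; see
    [unshuffle2_bihomog] and [shuffle2_bihomog]. *)
Definition bihomog r s : set (tensor (tensor TV TV) (tensor TW TW)) :=
  span [set p ⊗ q | p in tpow2 V r s & q in tpow2 W r s].

(** By bilinearity it is enough to treat pairs of words with letters v ⊗ w, on
    which the reordering is explicit. *)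
Lemma unshuffle2_bihomog r s x :
  tpow2 (tensor V W) r s x -> bihomog r s (unshuffle2 x).
Proof.
have ul := @unshuffle_linear k V W; have u2l := @unshuffle2_linear k V W.
move: x; apply: (span_lin u2l) => _ [x /tpow_tzip Hx [y /tpow_tzip Hy <-]].
move: x y Hx Hy; apply: (span_bilin (bilin_comp u2l (tens_bilin _ _))).
move=> _ _ [a [b [ar br ->]]] [c [d [cs ds ->]]]; apply: span_gen.
have Tw (U : lmodType k) (p q : seq U) :
    size p = r -> size q = s -> tpow2 U r s (tword p ⊗ tword q).
  move=> <- <-; apply: span_gen.
  by exists (tword p); [|exists (tword q)] => //; exact: tpow_tword.
exists (tword a ⊗ tword c); first exact: Tw.
exists (tword b ⊗ tword d); first exact: Tw.
rewrite /unshuffle2 tmap_tens// !unshuffle_tzip ?ar ?cs//.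
by rewrite interchange_tens.
Qed.

Lemma tpow_tzip_tuple n (s : n.-tuple V) (t : n.-tuple W) :
  tpow (tensor V W) n (tzip s t).
Proof.
have -> : tzip s t = tword [seq u.1 ⊗ u.2 | u <- zip s t].
  elim: n s t => [|n IHn] s t; first by rewrite (tuple0 s) (tuple0 t).
  by case/tupleP: s => v s; case/tupleP: t => w t /=; rewrite IHn.
have := tpow_tword [seq u.1 ⊗ u.2 | u <- zip s t].
by rewrite size_map size_zip !size_tuple minnn.
Qed.

Lemma shuffle2_bihomog r s x :
  bihomog r s x -> tpow2 (tensor V W) r s (shuffle2 x).
Proof.
have s2l := shuffle2_linear; have Tb (U U' : lmodType k) := tens_bilin U U'.
move: x; apply: (span_lin s2l) => _ [p Hp [q Hq <-]]; move: p q Hp Hq.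
apply: (span_bilin (bilin_comp s2l (Tb _ _))) => _ _ [a Ha [c Hc <-]] [b Hb [d Hd <-]].
move: a c Ha Hc; apply: (span_bilin (f := fun a c => shuffle2 ((a ⊗ c) ⊗ (b ⊗ d)))).
  exact: (bilin_comp (lin_comp s2l (@tens_linl k _ _ _)) (Tb _ _)).
move=> _ _ [a _ <-] [c _ <-]; move: b d Hb Hd.
apply: (span_bilin (f := fun b d => shuffle2 (_ ⊗ (b ⊗ d)))).
  exact: (bilin_comp (lin_comp s2l (@tens_linr k _ _ _)) (Tb _ _)).
move=> _ _ [b _ <-] [d _ <-]; apply: span_gen.
exists (tzip a b); first exact: tpow_tzip_tuple.
exists (tzip c d); first exact: tpow_tzip_tuple.
rewrite /shuffle2 interchange_tens tmap_tens; try exact: shuffle_linear.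
by rewrite !shuffle_tword.
Qed.

Variables (psi : tensor TV TV -> tensor TV TV) (phi : tensor TW TW -> tensor TW TW).
Hypotheses (Cpsi : cochain2 psi) (Cphi : cochain2 phi).

(** Unlike the description of [jmap] as the solution of an equation, this formula
    makes linearity and the preservation of bidegrees visible. *)
Lemma jmap_shuffle2 : jmap psi phi =1 shuffle2 \o tmap psi phi \o @unshuffle2 k V W.
Proof. by move=> x /=; rewrite -jmapE// unshuffle2K. Qed.

Lemma jmap_linear : linear (jmap psi phi).
Proof.
case: Cpsi Cphi => psil _ _ [phil _ _]; rewrite (funext jmap_shuffle2).
apply: lin_comp; last exact: unshuffle2_linear.
by apply: lin_comp; [exact: shuffle2_linear|exact: tmap_linear].
Qed.

Lemma jmap_tpow2 r s x :
  tpow2 (tensor V W) r s x -> tpow2 (tensor V W) r s (jmap psi phi x).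
Proof.
move=> /unshuffle2_bihomog Hx; rewrite jmap_shuffle2; apply: shuffle2_bihomog.
case: Cpsi Cphi => psil _ psiT [phil _ phiT]; move: (unshuffle2 x) Hx.
apply: (span_lin (tmap_linear psil phil)) => _ [p Hp [q Hq <-]]; apply: span_gen.
rewrite tmap_tens//; exists (psi p); first by rewrite -psiT; exists p.
by exists (phi q) => //; rewrite -phiT; exists q.
Qed.

End ExternalProduct.

Section JCochain.
Variables (k : fieldType) (V W : lmodType k).
Local Notation TV := (talg V).
Local Notation TW := (talg W).

(** [jmap] is compatible with composition, because conjugation is. *)
Lemma jmapK (psi psi' : tensor TV TV -> tensor TV TV)
    (phi phi' : tensor TW TW -> tensor TW TW) :
  cochain2 psi -> cochain2 psi' -> cochain2 phi -> cochain2 phi' ->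
  cancel psi psi' -> cancel phi phi' -> cancel (jmap psi phi) (jmap psi' phi').
Proof.
move=> Cpsi Cpsi' Cphi Cphi' psiK phiK x; apply: (@unshuffle2_inj k V W).
rewrite !jmapE//; case: Cpsi Cpsi' Cphi Cphi'.
move=> psil _ _ [psil' _ _] [phil _ _] [phil' _ _]; rewrite tmap_comp//.
move: (unshuffle2 x); apply: tens_eqlin; [|exact: lin_id|].
  by apply: tmap_linear; exact: lin_comp.
by move=> p q; rewrite tmap_tens /= ?psiK ?phiK//; exact: lin_comp.
Qed.

Lemma jmap_cochain2 (psi : tensor TV TV -> tensor TV TV)
    (phi : tensor TW TW -> tensor TW TW) :
  cochain2 psi -> cochain2 phi -> cochain2 (jmap psi phi).
Proof.
move=> Cpsi Cphi; have [psi' [Cpsi' psiK psi'K]] := cochain2_inv Cpsi.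
have [phi' [Cphi' phiK phi'K]] := cochain2_inv Cphi.
have jK := jmapK Cpsi Cpsi' Cphi Cphi' psiK phiK.
have j'K := jmapK Cpsi' Cpsi Cphi' Cphi psi'K phi'K.
split=> [||r s]; first exact: jmap_linear.
  by exists (jmap psi' phi').
apply/seteqP; split=> [_ [x Hx <-]|x Hx]; first exact: jmap_tpow2.
by exists (jmap psi' phi' x); [exact: jmap_tpow2|exact: j'K].
Qed.

End JCochain.

(** * Twisted tensor algebras *)

(** The type synonym carries T(V)_psi, the tensor algebra with the product
    twisted by psi, without disturbing the concatenation product of [talg V]. The
    proof of the cocycle condition is a parameter since the algebra axioms
    depend on it. *)
Definition ttwist (k : fieldType) (V : lmodType k)
  (psi : tensor (talg V) (talg V) -> tensor (talg V) (talg V))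
  (Zpsi : Z2 psi) : Type := talg V.

Section TwistedTensorAlgebra.
Variables (k : fieldType) (V : lmodType k).
Variable psi : tensor (talg V) (talg V) -> tensor (talg V) (talg V).
Hypothesis Zpsi : Z2 psi.

Let psil : linear psi. Proof. by case: Zpsi => - []. Qed.

Let ml := lin_comp (@amult_linear k (talg V)) psil.

Definition ttwist_mul (x y : talg V) : talg V := amult (psi (x ⊗ y)).

Fact ttwist_mul_linl y : linear (ttwist_mul^~ y).
Proof. exact: (lin_comp ml (@tens_linl k _ _ y)). Qed.

Fact ttwist_mul_linr x : linear (ttwist_mul x).
Proof. exact: (lin_comp ml (@tens_linr k _ _ x)). Qed.

(** The cocycle condition is associativity on homogeneous elements, and these span. *)
Fact ttwist_mulA : associative ttwist_mul.
Proof.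
have Ll := ttwist_mul_linl; have Lr := ttwist_mul_linr.
move=> x y z; move: x; apply: talg_eqlin => [|e x x'|r x Hx]; first exact: Ll.
  by rewrite !Ll.
move: y; apply: talg_eqlin => [e y y'|e y y'|s y Hy].
- by rewrite Ll Lr.
- by rewrite Lr Ll.
move: z; apply: talg_eqlin => [e z z'||t z Hz]; [by rewrite !Lr|exact: Lr|].
by case: Zpsi => _ + _ => /(_ r s t x y z Hx Hy Hz).
Qed.

Fact ttwist_mul1l : left_id 𝟙 ttwist_mul.
Proof.
move=> x; rewrite /ttwist_mul; case: Zpsi => _ _ /(_ x)[-> _].
by rewrite amult_tens amul1l.
Qed.

Fact ttwist_mul1r : right_id 𝟙 ttwist_mul.
Proof.
move=> x; rewrite /ttwist_mul; case: Zpsi => _ _ /(_ x)[_ ->].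
by rewrite amult_tens amul1r.
Qed.

HB.instance Definition _ := GRing.Lmodule.on (ttwist Zpsi).
HB.instance Definition _ := Lmodule_isUAlgebra.Build k (ttwist Zpsi)
  ttwist_mulA ttwist_mul1l ttwist_mul1r ttwist_mul_linl ttwist_mul_linr.

Lemma amult_ttwist (x : tensor (talg V) (talg V)) :
  amult (x : tensor (ttwist Zpsi) (ttwist Zpsi)) = amult (psi x).
Proof.
move: x; apply: (tens_eqlin (f := @amult k (ttwist Zpsi))) => [||x y].
- exact: amult_linear.
- exact: ml.
- exact: amult_tens.
Qed.

End TwistedTensorAlgebra.

Section TwistedReordering.
Variables (k : fieldType) (V W : lmodType k).
Local Notation TV := (talg V).
Local Notation TW := (talg W).

Lemma unshuffleM : {morph @unshuffle k V W : x y / x ⋅ y}.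
Proof. by apply: aliftM; apply: tmap_linear; exact: tgen_linear. Qed.

Lemma unshuffle1 : unshuffle (𝟙 : talg (tensor V W)) = 𝟙.
Proof. by apply: alift1; apply: tmap_linear; exact: tgen_linear. Qed.

Lemma unshuffle_amult z : unshuffle (amult z) =
  tmap (@amult k TV) (@amult k TW) (@unshuffle2 k V W z).
Proof.
have ul := @unshuffle_linear k V W; have ml := @amult_linear k.
move: z; apply: tens_eqlin => [||x y].
- exact: (lin_comp ul (ml _)).
- exact: (lin_comp (tmap_linear (ml _) (ml _)) (@unshuffle2_linear _ _ _)).
- by rewrite amult_tens unshuffleM tens_amulE /unshuffle2 tmap_tens.
Qed.

Variables (psi : tensor TV TV -> tensor TV TV) (phi : tensor TW TW -> tensor TW TW).
Hypotheses (Zpsi : Z2 psi) (Zphi : Z2 phi).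

(** Both sides are m ⊗ m after psi ⊗ phi applied to the reordered x ⊗ y: on the
    left by the definition of [jmap], on the right since the multiplication map
    of T(V)_psi is that of T(V) after psi. *)
Lemma unshuffle_ttwist x y :
  unshuffle (amult (jmap psi phi (x ⊗ y))) =
  (unshuffle x : tensor (ttwist Zpsi) (ttwist Zphi)) ⋅ unshuffle y.
Proof.
have ml (C : ualgType k) := @amult_linear k C.
have [[Cpsi _ _] [Cphi _ _]] := (Zpsi, Zphi).
have [[psil _ _] [phil _ _]] := (Cpsi, Cphi).
have ul := @unshuffle_linear k V W.
rewrite unshuffle_amult jmapE// (tmap_comp psil (ml _) phil (ml _)).
rewrite [RHS]tens_amulE /unshuffle2 (tmap_tens _ _ ul ul).
by apply: eq_tmap => z /=; rewrite -amult_ttwist.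
Qed.

(** The cocycle identity is pulled back along the injection [unshuffle] from the
    associativity of T(V)_psi ⊗ T(W)_phi. *)
Lemma jmap_Z2 : Z2 (jmap psi phi).
Proof.
have [[Cpsi _ Upsi] [Cphi _ Uphi]] := (Zpsi, Zphi).
have [[psil _ _] [phil _ _]] := (Cpsi, Cphi).
have ul := @unshuffle_linear k V W.
split; first exact: jmap_cochain2.
  move=> r s t x y z _ _ _; apply: (can_inj (@unshuffleK k V W)).
  by rewrite !unshuffle_ttwist amulA.
move=> a; split; apply: (@unshuffle2_inj k V W); rewrite jmapE//.
- rewrite /unshuffle2 tmap_tens// unshuffle1; move: (unshuffle a).
  have L := lin_comp (@interchange_linear k TV TW TV TW) (@tens_linr k _ _ 𝟙).
  apply: tens_eqlin; [exact: lin_comp (tmap_linear psil phil) L|exact: L|].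
  move=> p q; rewrite interchange_tens tmap_tens//.
  by rewrite (Upsi p).1 (Uphi q).1.
- rewrite /unshuffle2 tmap_tens// unshuffle1; move: (unshuffle a).
  have L := lin_comp (@interchange_linear k TV TW TV TW) (@tens_linl k _ _ 𝟙).
  apply: tens_eqlin; [exact: lin_comp (tmap_linear psil phil) L|exact: L|].
  move=> p q; rewrite interchange_tens tmap_tens//.
  by rewrite (Upsi p).2 (Uphi q).2.
Qed.

End TwistedReordering.

(** * Quantum spaces with a common ambient algebra *)

Section QuantumSubspaces.
Variables (k : fieldType) (X : ualgType k).

Definition is_embedding (P : quantum_space k) (p : qalg P -> X) : Prop :=
  [/\ linear p, p 𝟙 = 𝟙, {morph p : x y / x ⋅ y} & injective p].

(** The elements x with p x in the image of q form a subalgebra containing the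
    generators of P, hence all of P; f is then q^-1 after p. *)
Lemma embedding_factor (P Q : quantum_space k) (p : qalg P -> X) (q : qalg Q -> X) :
  is_embedding p -> is_embedding q ->
  p @` range (qinc P) `<=` q @` range (qinc Q) ->
  exists2 f : qalg P -> qalg Q, is_qmor f & forall x, q (f x) = p x.
Proof.
move=> [pl p1 pM pI] [ql q1 qM qI] pq.
have ex x : exists y, q y = p x.
  elim: (qinc_gen x) => {x} [|x Px|x y _ [x' Hx] _ [y' Hy]|a x _ [x' Hx]|
                            x y _ [x' Hx] _ [y' Hy]].
  - by exists 𝟙; rewrite p1.
  - by have [|y _ <-] := pq (p x); [exists x|exists y].
  - by exists (x' + y'); rewrite (linD ql) (linD pl) Hx Hy.
  - by exists (a *: x'); rewrite (linZ _ ql) (linZ _ pl) Hx.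
  - by exists (x' ⋅ y'); rewrite qM pM Hx Hy.
have [f fE] := choice ex; exists f => //; split.
- by move=> a x y; apply: qI; rewrite ql !fE pl.
- by apply: qI; rewrite fE p1.
- by move=> x y; apply: qI; rewrite qM !fE pM.
- move=> _ [x Px <-]; have [|y Qy /esym xy] := pq (p x); first by exists x.
  by rewrite -(qI y (f x)) // fE.
Qed.

(** A quantum space inside an algebra X is determined by its space of generators. *)
Lemma qiso_embeddings (P Q : quantum_space k) (p : qalg P -> X) (q : qalg Q -> X) :
  is_embedding p -> is_embedding q ->
  p @` range (qinc P) = q @` range (qinc Q) -> qiso P Q.
Proof.
move=> Ep Eq pq.
have [|f fm fE] := embedding_factor Ep Eq; first by rewrite pq.
have [|g gm gE] := embedding_factor Eq Ep; first by rewrite pq.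
have [[_ _ _ pI] [_ _ _ qI]] := (Ep, Eq).
by exists f, g; split=> // x; [apply: pI; rewrite gE fE|apply: qI; rewrite fE gE].
Qed.

End QuantumSubspaces.

(** * Twisting the product of quantum spaces *)

Section CircEmbedding.
Variables (k : fieldType) (A B : quantum_space k).

Definition circ_val (x : qalg (A ∘ B)) : tensor (qalg A) (qalg B) :=
  val (x : circ_alg A B).

Lemma circ_val_embedding : is_embedding circ_val.
Proof. by split=> //; exact: val_inj. Qed.

Lemma circ_val_linear : linear circ_val.
Proof. by case: circ_val_embedding. Qed.

Lemma circ_val_inj : injective circ_val.
Proof. exact: val_inj. Qed.

(** Both sides are algebra morphisms on T(A_1 ⊗ B_1) with the same values on
    generators. *)
Lemma circ_val_qPi x : circ_val (@qPi k (A ∘ B) x) =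
  tmap (@qPi k A) (@qPi k B) (unshuffle x).
Proof.
have [vl v1 vM _] := circ_val_embedding.
have pl (C : quantum_space k) := @qPi_linear k C.
have ul := @unshuffle_linear k (qgen A) (qgen B).
have gl (U : lmodType k) := @tgen_linear k U.
have L := tmap_linear (pl A) (pl B).
have M := tmapM (pl A) (pl B) (@qPiM k A) (@qPiM k B).
elim/talg_ind: x => [v||x y Hx Hy||x y Hx Hy|a x Hx].
- rewrite qPi_gen /unshuffle alift_gen; last exact: tmap_linear.
  rewrite (tmap_comp (gl _) (pl _) (gl _) (pl _)).
  by apply: eq_tmap => w /=; rewrite qPi_gen.
- by rewrite qPi1 unshuffle1 v1 (tmap_tens _ _ (pl A) (pl B)) !qPi1.
- by rewrite qPiM vM Hx Hy unshuffleM M.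
- by rewrite (lin0 ul) (lin0 L) (lin0 (pl _)) (lin0 vl).
- by rewrite (linD (pl _)) (linD vl) Hx Hy (linD ul) (linD L).
- by rewrite (linZ _ (pl _)) (linZ _ vl) Hx (linZ _ ul) (linZ _ L).
Qed.

(** The embedding of the square of A ∘ B in (A ⊗ A) ⊗ (B ⊗ B), where the induced
    maps Psi and Phi act. *)
Definition circ_val2 (x : tensor (qalg (A ∘ B)) (qalg (A ∘ B))) :=
  interchange (tmap circ_val circ_val x).

Lemma circ_val2_linear : linear circ_val2.
Proof.
exact: lin_comp (@interchange_linear _ _ _ _ _)
                (tmap_linear circ_val_linear circ_val_linear).
Qed.

Lemma circ_val2_inj : injective circ_val2.
Proof.
apply: inj_comp; first exact: can_inj (@interchangeK _ _ _ _ _).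
by apply: tmap_inj; try exact: circ_val_linear; exact: circ_val_inj.
Qed.

Lemma circ_val2_qPi2 x : circ_val2 (@qPi2 k (A ∘ B) x) =
  tmap (@qPi2 k A) (@qPi2 k B) (unshuffle2 x).
Proof.
have pl (C : quantum_space k) := @qPi_linear k C.
have ul := @unshuffle_linear k (qgen A) (qgen B).
have L := tmap_linear (pl A) (pl B); have vl := circ_val_linear.
rewrite /circ_val2 /unshuffle2 -(interchange_tmap (pl _) (pl _) (pl _) (pl _)).
rewrite (tmap_comp ul L ul L) /qPi2 (tmap_comp (pl _) vl (pl _) vl).
congr (interchange _).
by apply: eq_tmap => y; exact: circ_val_qPi.
Qed.

End CircEmbedding.

(** If Psi kills the class of x, then psi x lies in the kernel, which is psi of
    the kernel; as psi is injective, x itself lies in the kernel. *)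
Lemma twPsi_inj (k : fieldType) (A : quantum_space k)
    (psi : tensor (talg (qgen A)) (talg (qgen A)) ->
           tensor (talg (qgen A)) (talg (qgen A))) :
  Z2 psi -> admissible A psi -> injective (@twPsi k A psi).
Proof.
move=> Zpsi Apsi; have L := twPsi_linear Zpsi Apsi; have [[_ /bij_inj pI _] _ _] := Zpsi.
have K a : twPsi psi a = 0 -> a = 0.
  have [x <-] := qPi2_surj a; rewrite (twPsiE Zpsi)// => px0.
  have : [set x | qPi2 x = 0 :> tensor (qalg A) (qalg A)] (psi x) by [].
  by rewrite -Apsi => -[y y0 /pI <-].
move=> a b ab; apply/eqP; rewrite -subr_eq0; apply/eqP/K.
by rewrite -scaleN1r addrC L ab scaleN1r addNr.
Qed.

Lemma qPi_ttwist (k : fieldType) (A : quantum_space k)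
    (psi : tensor (talg (qgen A)) (talg (qgen A)) ->
           tensor (talg (qgen A)) (talg (qgen A)))
    (Zpsi : Z2 psi) (Apsi : admissible A psi) :
  {morph (@qPi k A : ttwist Zpsi -> twalg Zpsi Apsi) : x y / x ⋅ y}.
Proof. by move=> x y; exact/esym/twmulE. Qed.

Section CircTwist.
Variables (k : fieldType) (A B : quantum_space k).
Variables (psi : tensor (talg (qgen A)) (talg (qgen A)) ->
                 tensor (talg (qgen A)) (talg (qgen A)))
          (phi : tensor (talg (qgen B)) (talg (qgen B)) ->
                 tensor (talg (qgen B)) (talg (qgen B))).
Hypotheses (Zpsi : Z2 psi) (Zphi : Z2 phi).
Hypotheses (Apsi : admissible A psi) (Aphi : admissible B phi).

(** Thus j(psi, phi) descends to the restriction of Psi ⊗ Phi. *)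
Lemma circ_val2_jmap x :
  circ_val2 (@qPi2 k (A ∘ B) (jmap psi phi x)) =
  tmap (twPsi psi) (twPsi phi) (circ_val2 (@qPi2 k (A ∘ B) x)).
Proof.
have [[Cpsi _ _] [Cphi _ _]] := (Zpsi, Zphi).
have [[psil _ _] [phil _ _]] := (Cpsi, Cphi).
have pl (C : quantum_space k) := @qPi2_linear k C.
have tl := twPsi_linear Zpsi Apsi; have tl' := twPsi_linear Zphi Aphi.
rewrite !circ_val2_qPi2 jmapE// (tmap_comp psil (pl _) phil (pl _)).
rewrite (tmap_comp (pl _) tl (pl _) tl').
by apply: eq_tmap => z /=; rewrite twPsiE.
Qed.

Lemma jmap_admissible : admissible (A ∘ B) (jmap psi phi).
Proof.
have tl := twPsi_linear Zpsi Apsi; have tl' := twPsi_linear Zphi Aphi.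
have tI := tmap_inj tl tl' (twPsi_inj Zpsi Apsi) (twPsi_inj Zphi Aphi).
have vl := @circ_val2_linear k A B; have L := tmap_linear tl tl'.
have [[_ [j' jK j'K] _] _ _] := jmap_Z2 Zpsi Zphi.
have kerj x : @qPi2 k (A ∘ B) (jmap psi phi x) = 0 <-> @qPi2 k (A ∘ B) x = 0.
  split=> x0; apply: circ_val2_inj; last first.
    by rewrite circ_val2_jmap x0 (lin0 vl) (lin0 L).
  by apply: tI; rewrite -circ_val2_jmap x0 (lin0 vl) (lin0 L).
apply/seteqP; split=> [_ [x x0 <-]|x x0]; first exact/kerj.
by exists (j' x) => //; apply/kerj; rewrite j'K.
Qed.

End CircTwist.

Section CircTwistIso.
Variables (k : fieldType) (A B : quantum_space k).
Variables (psi : tensor (talg (qgen A)) (talg (qgen A)) ->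
                 tensor (talg (qgen A)) (talg (qgen A)))
          (phi : tensor (talg (qgen B)) (talg (qgen B)) ->
                 tensor (talg (qgen B)) (talg (qgen B))).
Hypotheses (Zpsi : Z2 psi) (Zphi : Z2 phi).
Hypotheses (Apsi : admissible A psi) (Aphi : admissible B phi).

Let Zj := jmap_Z2 Zpsi Zphi.
Let Aj := jmap_admissible Zpsi Zphi Apsi Aphi.

(** The map is [circ_val]; only the products on its source and target change. *)
Definition twist_circ_val (x : qalg (twist (A ∘ B) Zj Aj)) :
    tensor (qalg (twist A Zpsi Apsi)) (qalg (twist B Zphi Aphi)) :=
  @circ_val k A B x.

(** Every element of A ∘ B is the image of some x in T(A_1 ⊗ B_1), and on such
    images the map is [tmap qPi qPi] after [unshuffle], a composite of morphisms
    for the twisted products. *)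
Lemma twist_circ_val_embedding : is_embedding twist_circ_val.
Proof.
split; [exact: circ_val_linear|by []| |exact: circ_val_inj].
move=> x y; have [x' <-] := @qPi_surj k (A ∘ B) x.
have [y' <-] := @qPi_surj k (A ∘ B) y.
rewrite -(qPi_ttwist Aj) /twist_circ_val !circ_val_qPi.
rewrite (unshuffle_ttwist Zpsi Zphi).
apply: (tmapM (A := ttwist Zpsi) (B := ttwist Zphi)
              (A' := twalg Zpsi Apsi) (B' := twalg Zphi Aphi)).
- exact: (@qPi_linear k A).
- exact: (@qPi_linear k B).
- exact: qPi_ttwist.
- exact: qPi_ttwist.
Qed.

Lemma circ_twist_iso :
  qiso (twist A Zpsi Apsi ∘ twist B Zphi Aphi) (twist (A ∘ B) Zj Aj).
Proof.
have E := circ_val_embedding (twist A Zpsi Apsi) (twist B Zphi Aphi).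
apply: (qiso_embeddings E twist_circ_val_embedding).
apply/seteqP; split=> _ [_ [v _ <-] <-].
  by exists (qinc (twist (A ∘ B) Zj Aj) v) => //; exists v.
by exists (qinc (twist A Zpsi Apsi ∘ twist B Zphi Aphi) v) => //; exists v.
Qed.

End CircTwistIso.

Theorem theorem15 (R : realType) (c : scalars)
    (A B : quantum_space (ground_field R c))
    (psi : tensor (talg (qgen A)) (talg (qgen A)) ->
           tensor (talg (qgen A)) (talg (qgen A)))
    (phi : tensor (talg (qgen B)) (talg (qgen B)) ->
           tensor (talg (qgen B)) (talg (qgen B)))
    (Zpsi : Z2 psi) (Zphi : Z2 phi)
    (Apsi : admissible A psi) (Aphi : admissible B phi) :
  exists (Zj : Z2 (jmap psi phi))
         (Aj : admissible (A ∘ B) (jmap psi phi)),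
    qiso (twist A Zpsi Apsi ∘ twist B Zphi Aphi) (twist (A ∘ B) Zj Aj).
Proof. by do 2 eexists; exact: circ_twist_iso. Qed.
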